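(* Let $d\in\mathbb N$, use the scaling $\mathfrak s=(1,\dots,1)$, and let $0<\alpha<1<\eta<2$. There exists a constant $C>0$ such that for all $\epsilon>0$ and all centered germs $U$ over $\epsilon\mathbb Z^d$ with $\|U\|_{G^\eta(\epsilon\mathbb Z^d)}<\infty$ it holds $$\|U\|_{G^\eta(\epsilon\mathbb Z^d)}\le C\big([\Delta_\epsilon U]_{G^{\eta-2}(\epsilon\mathbb Z^d)}+[U]_{G^{\eta,\alpha}(\epsilon\mathbb Z^d)}\big).$$
   Context: Distance $d(x,y):=\sum_{i=1}^d|x_i-y_i|$, $B_R(x)$ the corresponding open ball; $\mathcal P_k$ denotes polynomials on $\mathbb R^d$ of degree at most $k$. A germ over $D\subseteq\mathbb R^d$ is a family $U=(U_x)_{x\in D}$ of functions $U_x:D\to\mathbb C$ (continuous; automatic for $D=\epsilon\mathbb Z^d$). For $\eta>0$, $\|U\|_{G^\eta(D)}$ is the infimum of all $M>0$ with $|U_x(y)|\le M\,d(x,y)^\eta$ for all $x,y\in D$. For $0<\alpha<\eta$, $[U]_{G^{\eta,\alpha}(D)}$ is the infimum of all $M>0$ such that for all $x,y\in D$ there is $P\in\mathcal P_{\lfloor\eta\rfloor}$ with $|(U_x-U_y-P)(z)|\le M\,d(y,z)^\alpha(d(x,y)+d(y,z))^{\eta-\alpha}$ for all $z\in D$. The discrete Laplacian is $\Delta_\epsilon u(y):=\epsilon^{-2}\sum_{z\in\epsilon\mathbb Z^d,\,d(y,z)=\epsilon}(u(z)-u(y))$, and $\Delta_\epsilon U:=(\Delta_\epsilon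 U_x)_x$. For $\gamma<0$, let $k:=\lceil|\gamma|\rceil$, let $\mathcal B$ be the set of $\varphi\in C_c^\infty(\mathbb R^d)$ supported in $B_1(0)$ with $\sup_{|\beta|\le k}\sup|\partial^\beta\varphi|\le 1$, and $\varphi_x^\lambda(y):=\lambda^{-d}\varphi((y-x)/\lambda)$. With $\langle f,g\rangle_\epsilon:=\epsilon^d\sum_{x\in\epsilon\mathbb Z^d}f(x)g(x)$, for a family $V=(V_x)_{x\in\epsilon\mathbb Z^d}$ of functions on $\epsilon\mathbb Z^d$ set $[V]_{G^\gamma(\epsilon\mathbb Z^d)}:=\sup_{\varphi\in\mathcal B}\sup_{x\in\epsilon\mathbb Z^d,\,\lambda\ge\epsilon}\lambda^{-\gamma}|\langle V_x,\varphi_x^\lambda\rangle_\epsilon|$. A germ $U$ over $\epsilon\mathbb Z^d$ is centered if $U_x(x)=0$ and $D_jU_x(x)=0$ for all $x\in\epsilon\mathbb Z^d$, $j\in\{1,\dots,d\}$, where $D_jU_x(x):=\epsilon^{-1}(U_x(x+\epsilon\mathbf e_j)-U_x(x))$. *)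

(* Defs.v *)
From HB Require Import structures.
From mathcomp Require Import all_boot all_order all_algebra.
From mathcomp Require Import all_classical all_reals all_analysis.
From mathcomp Require Import complex.
Set Implicit Arguments. Unset Strict Implicit. Unset Printing Implicit Defensive.
Import Order.TTheory GRing.Theory Num.Theory.
Import numFieldNormedType.Exports.
Local Open Scope classical_set_scope.
Local Open Scope ring_scope.
Import ComplexField.

Section Defs.
Variables (R : realType) (d : nat).

Definition l1dist (x y : 'rV[R]_d) : R := \sum_(i < d) `|x 0 i - y 0 i|.

(* lattice points of eps Z^d are indexed by k : 'rV[int]_d, at position eps*k *)
Definition lpos (eps : R) (k : 'rV[int]_d) : 'rV[R]_d :=
  eps *: map_mx (fun z : int => z%:~R) k.

Definition ldist (eps : R) (k l : 'rV[int]_d) : R := l1dist (lpos eps k) (lpos eps l).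

Definition cnorm (z : R[i]) : R := Normc.normc z.

(* a germ over eps Z^d : U x = U_x, a function on eps Z^d *)
Definition germ := 'rV[int]_d -> 'rV[int]_d -> R[i].

Definition is_poly_le (n : nat) (P : 'rV[R]_d -> R[i]) : Prop :=
  exists c : seq ({ffun 'I_d -> nat} * R[i]),
    (forall p, p \in c -> (\sum_(i < d) p.1 i <= n)%N) /\
    forall z, P z = \sum_(p <- c) p.2 * \prod_(i < d) ((z 0 i)%:C%C) ^+ (p.1 i).

Definition Gnorm (eps eta : R) (U : germ) : \bar R :=
  ereal_inf [set M%:E | M in [set M : R | 0 < M /\
     forall x y, cnorm (U x y) <= M * (ldist eps x y) `^ eta]].

Definition Gseminorm (eps eta alpha : R) (U : germ) : \bar R :=
  ereal_inf [set M%:E | M in [set M : R | 0 < M /\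
     forall x y, exists P, is_poly_le `|Num.floor eta|%N P /\
       forall z, cnorm (U x z - U y z - P (lpos eps z)) <=
         M * (ldist eps y z) `^ alpha * (ldist eps x y + ldist eps y z) `^ (eta - alpha)]].

Definition dlapl (eps : R) (u : 'rV[int]_d -> R[i]) (y : 'rV[int]_d) : R[i] :=
  (eps ^- 2)%:C%C * (\sum_(z \in [set z | ldist eps y z = eps]) (u z - u y))%R.

Definition dlapl_germ (eps : R) (U : germ) : germ := fun x => dlapl eps (U x).

Definition partial (j : 'I_d) (f : 'rV[R]_d -> R) : 'rV[R]_d -> R :=
  fun x => derive f x (delta_mx 0 j).

Definition pder (s : seq 'I_d) (f : 'rV[R]_d -> R) : 'rV[R]_d -> R :=
  foldr partial f s.

Definition smooth (f : 'rV[R]_d -> R) : Prop :=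
  forall s : seq 'I_d, continuous (pder s f) /\
    forall (j : 'I_d) (x : 'rV[R]_d), derivable (pder s f) x (delta_mx 0 j).

Definition testfun (k : nat) (phi : 'rV[R]_d -> R) : Prop :=
  smooth phi /\
  closure [set x | phi x != 0] `<=` [set x | l1dist x 0 < 1] /\
  forall s : seq 'I_d, (size s <= k)%N -> forall x, `|pder s phi x| <= 1.

Definition rescale (phi : 'rV[R]_d -> R) (x : 'rV[R]_d) (lam : R) : 'rV[R]_d -> R :=
  fun y => lam ^- d * phi (lam^-1 *: (y - x)).

Definition lpair (eps : R) (f : 'rV[int]_d -> R[i]) (g : 'rV[R]_d -> R) : R[i] :=
  (eps ^+ d)%:C%C * (\sum_(z \in [set: 'rV[int]_d]) (f z * (g (lpos eps z))%:C%C))%R.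

Definition Gneg (eps gamma : R) (V : germ) : \bar R :=
  ereal_sup [set r : \bar R | exists (phi : 'rV[R]_d -> R) (x : 'rV[int]_d) (lam : R),
     [/\ testfun `|Num.ceil (- gamma)|%N phi, eps <= lam &
      r = (lam `^ (- gamma) *
           cnorm (lpair eps (V x) (rescale phi (lpos eps x) lam)))%:E]].

End Defs.

Section Centered.
Variables (R : realType) (d : nat).
Import ComplexField.
Local Open Scope ring_scope.
Definition centered (eps : R) (U : germ R d) : Prop :=
  forall x : 'rV[int]_d,
    U x x = 0 /\
    forall j : 'I_d, (eps^-1)%:C%C * (U x (x + delta_mx 0 j) - U x x) = 0.
End Centered.

(* Main.v *)
Require Import Defs.
From HB Require Import structures.
From mathcomp Require Import all_boot all_order all_algebra.
From mathcomp Require Import all_classical all_reals all_analysis.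
From mathcomp Require Import complex.
From mathcomp Require Import ring lra zify.
Import Order.TTheory GRing.Theory Num.Theory.
Local Open Scope ring_scope.
Local Open Scope ereal_scope.

(* After rescaling to eps = 1 and splitting into real and imaginary parts, fix x
   and y at distance r and let v be the average of U_x at scale lam = delta r (no
   averaging if delta r <= 1) against an even bump.
   - Averaging turns the distributional bound on the Laplacian into a pointwise
     one: near any z, U_x is U_z plus an affine function plus the error of the
     three-point condition, and for the latter the Laplacian is moved onto the
     bump. It moves v away from U_x by at most M (delta r)^eta plus a multiple of
     the seminorm, M being any constant with |U_x(y)| <= M d(x,y)^eta.
   - A reflection argument with a quadratic barrier, exact on the lattice, bounds
     the discrete gradient on the scale K r. Applied to v and then to its
     increments, it shows that b |-> v(x + b) - v(x) is additive on the ball of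
     radius r up to a small multiple, of order K^(eta - 2), of M r^eta, plus a
     multiple of the two seminorms.
   - An almost additive function is controlled by its values at scale delta r,
     which are O(M (delta r)^eta); reaching r costs a factor 1/delta, and
     delta^(eta - 1) is small. If delta r <= 1 these values vanish by centering.
   Choosing delta and then K absorbs M. *)

(** * A smooth even bump on the line, with control of its derivatives *)

Section Bump.
Set Implicit Arguments.
Unset Strict Implicit.
Unset Printing Implicit Defensive.
Local Open Scope classical_set_scope.
Local Open Scope ring_scope.
Import numFieldNormedType.Exports.
Context {R : realType}.
Implicit Types (a s t x : R) (n m : nat).

(** The hypothesis puts the difference quotient within [C * |h|] of [l]. It serves affine maps, with
    [C = 0], and the flat point of [expinv] at zero. *)
Lemma is_derive_quadratic_error (f : R -> R) x l C :
  (forall h, `|f (h + x) - f x - h * l| <= C * h ^+ 2) -> is_derive x 1 f l.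
Proof.
move=> fC.
have C0 : 0 <= C by have := le_trans (normr_ge0 _) (fC 1); rewrite expr1n mulr1.
have fl : (fun h => h^-1 *: ((f \o shift x) (h *: 1) - f x)) @ 0^' --> l.
  apply/cvgrPdist_le => e e0; near=> h.
  have h0 : h != 0 by near: h; exact: nbhs_dnbhs_neq.
  rewrite distrC /GRing.scale /= mulr1.
  have -> : h^-1 * (f (h + x) - f x) - l = h^-1 * (f (h + x) - f x - h * l).
    by rewrite [RHS]mulrBr [X in _ = _ - X]mulrA mulVf // mul1r.
  rewrite normrM normfV ler_pdivrMl ?normr_gt0 //.
  apply: le_trans (fC h) _.
  rewrite -(real_normK (num_real h)) expr2 mulrCA ler_wpM2l //.
  have -> : e = (C + 1) * (e / (C + 1)) by rewrite mulrC divfK // gt_eqF // ltr_pwDr.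
  have he : `|h| <= e / (C + 1).
    near: h; apply: dnbhs0_le; rewrite divr_gt0 // ltr_pwDr //.
  apply: ler_pM => //; first by rewrite lerDl.
split; [exact: cvgP fl | exact: cvg_lim fl].
Unshelve. all: by end_near.
Qed.

(** The negative powers are built in because differentiating one of these functions gives a
    combination of two others. All of them are bounded, so every derivative of the bump is bounded
    as well. *)
Definition expinv n s : R := if 0 < s then s ^- n * expR (- s^-1) else 0.

Lemma expinv_ge0 n s : 0 <= expinv n s.
Proof.
rewrite /expinv; case: ifPn => // s0.
by rewrite mulr_ge0 ?expR_ge0 // invr_ge0 exprn_ge0 // ltW.
Qed.

Lemma expinv_le0 n s : s <= 0 -> expinv n s = 0.
Proof. by move=> s0; rewrite /expinv ltNge s0. Qed.

Lemma exprn_expRN_le n t : 0 <= t -> t ^+ n * expR (- t) <= n`!%:R.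
Proof.
move=> t0; rewrite expRN ler_pdivrMr ?expR_gt0 //.
case: n => [|n]; first by rewrite expr0 fact0 mul1r -expR0 ler_expR.
rewrite mulrC -ler_pdivrMr ?ltr0n ?fact_gt0 //.
by apply: le_trans (expR_ge1Dxn n t0); rewrite lerDr.
Qed.

Lemma expinv_le n s : expinv n s <= n`!%:R.
Proof.
rewrite /expinv; case: ifPn => // s0.
by rewrite -exprVn exprn_expRN_le // invr_ge0 ltW.
Qed.

Lemma expinvS n s : expinv n s = s * expinv n.+1 s.
Proof.
rewrite /expinv; case: ifPn => [s0|_]; last by rewrite mulr0.
by rewrite mulrA exprS invfM mulrA mulfV ?gt_eqF // mul1r.
Qed.

Lemma is_derive_expinv n s :
  is_derive s 1 (expinv n) (expinv n.+2 s - n%:R * expinv n.+1 s).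
Proof.
have [s0|s0|->] := ltgtP s 0.
- have -> : expinv n.+2 s - n%:R * expinv n.+1 s = 0.
    by rewrite !expinv_le0 ?mulr0 ?subrr // ltW.
  have d0 : is_derive s 1 (fun=> 0 : R) 0 by exact: is_derive_cst.
  apply: near_eq_is_derive d0.
  near=> t; rewrite expinv_le0 // ltW //.
  by near: t; exact: lt_nbhsl.
- have s1 : s != 0 by rewrite gt_eqF.
  have dV : is_derive s 1 (fun t => t^-1) (- s ^- 2 *: 1).
    have did : is_derive s 1 (fun t : R => t) 1 by exact: is_derive_id.
    exact: is_deriveV did.
  have dE : is_derive s 1 ((fun t => t^-1) ^+ n * (expR \o (- (fun t => t^-1))))
     (expinv n.+2 s - n%:R * expinv n.+1 s).
    apply: is_derive_eq.
    rewrite /expinv s0 /GRing.scale /= exprfctE.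
    rewrite -!exprVn !mulr1 opprfctE.
    case: n => [|n]; first by rewrite /= !expr0; ring.
    by rewrite /= !exprS; ring.
  apply: near_eq_is_derive dE.
  near=> t; rewrite /expinv /= ifT.
    by rewrite -exprVn fctE exprfctE.
  by near: t; exact: lt_nbhsr.
- have -> : expinv n.+2 0 - n%:R * expinv n.+1 0 = 0 :> R.
    by rewrite !expinv_le0 ?mulr0 ?subrr.
  apply: (is_derive_quadratic_error (C := (n.+2)`!%:R)) => h.
  rewrite addr0 mulr0 subr0 (@expinv_le0 n 0) // subr0 ger0_norm ?expinv_ge0 //.
  (* Trading two powers writes [expinv n h] as [h ^+ 2 * expinv n.+2 h], so the remainder at the
     origin is quadratic, on both sides of it. *)
  rewrite expinvS expinvS mulrA -expr2 mulrC ler_wpM2r ?sqr_ge0 //.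
  exact: expinv_le.
Unshelve. all: by end_near.
Qed.

(* Bounded functions forming a class closed under differentiation: smoothness of
   the bump and bounds on its derivatives come together. *)
Inductive bump_span (a : R) : (R -> R) -> Prop :=
| bump_base m n : bump_span a (fun t => expinv m (1 + t / a) * expinv n (1 - t / a))
| bump_add f g : bump_span a f -> bump_span a g -> bump_span a (fun t => f t + g t)
| bump_scale c f : bump_span a f -> bump_span a (fun t => c * f t).

Lemma bump_span_bounded a f : bump_span a f -> exists2 C, 0 <= C & forall t, `|f t| <= C.
Proof.
elim=> [m n|g h _ [C C0 gC] _ [D D0 hD]|c g _ [C C0 gC]].
- exists (m`!%:R * n`!%:R); first by rewrite mulr_ge0.
  move=> t; rewrite normrM !ger0_norm ?expinv_ge0 //.
  by apply: ler_pM; rewrite ?expinv_ge0 ?expinv_le.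
- exists (C + D); first exact: addr_ge0.
  by move=> t; apply: le_trans (ler_normD _ _) _; exact: lerD.
- exists (`|c| * C); first exact: mulr_ge0.
  by move=> t; rewrite normrM ler_wpM2l.
Qed.

Lemma bump_span_supp a f t : 0 < a -> bump_span a f -> a <= `|t| -> f t = 0.
Proof.
move=> a0 + ta; elim=> [m n|g h _ -> _ ->|c g _ ->]; last 2 first.
- by rewrite addr0.
- by rewrite mulr0.
have {ta} : (1 + t / a <= 0) \/ (1 - t / a <= 0).
  have [t0|t0] := leP 0 t.
    by right; rewrite subr_le0 ler_pdivlMr // mul1r; rewrite ger0_norm in ta.
  left; rewrite -lerBrDl sub0r ler_pdivrMr // mulN1r lerNr.
  by rewrite ltr0_norm in ta.
by case=> h; rewrite (expinv_le0 _ h) ?mul0r ?mulr0.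
Qed.

(** By the product and chain rules a base product turns into four others with larger exponents and
    constant coefficients. Iterating this yields all higher derivatives. *)
Lemma bump_span_derive a f : bump_span a f ->
  exists2 g, bump_span a g & forall t, is_derive t 1 f (g t).
Proof.
elim=> [m n|g h _ [g' Bg dg] _ [h' Bh dh]|c g _ [g' Bg dg]]; last 2 first.
- exists (fun t => g' t + h' t); first exact: bump_add.
  by move=> t; exact: is_deriveD.
- exists (fun t => c * g' t); first exact: bump_scale.
  by move=> t; exact: is_deriveZ.
pose E i j t := expinv i (1 + t / a) * expinv j (1 - t / a).
exists (fun t => (a^-1 * (E m.+2 n t + (- m%:R) * E m.+1 n t)) +
            (- a^-1) * (E m n.+2 t + (- n%:R) * E m n.+1 t)).
  by apply: bump_add; apply: bump_scale; apply: bump_add; try apply: bump_scale;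
    exact: bump_base.
move=> t.
have d1 : is_derive t 1 (fun t : R => 1 + t / a) a^-1.
  apply: (is_derive_quadratic_error (C := 0)) => h.
  by rewrite mul0r (_ : _ - _ = 0) ?normr0 //; ring.
have d2 : is_derive t 1 (fun t : R => 1 - t / a) (- a^-1).
  apply: (is_derive_quadratic_error (C := 0)) => h.
  by rewrite mul0r (_ : _ - _ = 0) ?normr0 //; ring.
have D1 := is_derive1_comp (g := fun t => 1 + t / a) (is_derive_expinv m _) d1.
have D2 := is_derive1_comp (g := fun t => 1 - t / a) (is_derive_expinv n _) d2.
have := is_deriveM D1 D2.
move=> D; apply: is_derive_eq D _.
rewrite /GRing.scale /= /E; ring.
Qed.

(** The sequence [th] carries the bump together with all its derivatives. Scaling by
    [(1 + C0 + C1)^-1] makes the bump and its first derivative at most one; the second derivative,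
    needed for a Laplacian, only has to be bounded. *)
Lemma bump1_exists (a : R) : 0 < a -> exists th : nat -> R -> R,
  [/\ forall n t, is_derive t 1 (th n) (th n.+1 t),
      forall n t, a <= `|t| -> th n t = 0,
      forall t, th 0%N (- t) = th 0%N t,
      (forall t, 0 <= th 0%N t <= 1) /\ (forall t, `|th 1%N t| <= 1) &
      (exists2 C, 0 < C & forall t, `|th 2%N t| <= C) /\
      (exists2 c, 0 < c & forall t, `|t| <= a / 2 -> c <= th 0%N t)].
Proof.
move=> a0; pose f t := expinv 0 (1 + t / a) * expinv 0 (1 - t / a).
have Bf : bump_span a f by exact: bump_base.
have [g Bg fg] := bump_span_derive Bf.
have [C0 C0ge fC] := bump_span_bounded Bf.
have [C1 C1ge gC] := bump_span_bounded Bg.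
pose c := (1 + C0 + C1)^-1.
have c0 : 0 < c by rewrite invr_gt0 ltr_pwDl // ltr_pwDl.
pose F n := derive1n n (fun t => c * f t).
have BF n : bump_span a (F n) /\ forall t, is_derive t 1 (F n) (F n.+1 t).
  elim: n => [|n [Bn dn]].
    split; first exact: bump_scale.
    move=> t; have [h Bh dh] := bump_span_derive (bump_scale c Bf).
    by apply: is_derive_eq (dh t) _; rewrite /F derive1nS derive1n0 derive1E derive_val.
  have [h Bh dh] := bump_span_derive Bn.
  have Fh : F n.+1 = h.
    by apply/funext => t; rewrite /F derive1nS derive1E; have [_ ->] := dh t.
  split; first by rewrite Fh.
  rewrite Fh; have [h' Bh' dh'] := bump_span_derive Bh => t.
  apply: is_derive_eq (dh' t) _.
  by rewrite /F derive1nS -/(F n.+1) Fh derive1E; have [_ ->] := dh' t.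
have F1 t : F 1%N t = c * g t.
  rewrite /F derive1nS derive1n0 derive1E.
  by have [_ ->] : is_derive t 1 (fun t => c * f t) (c * g t) by exact: is_deriveZ.
have cle C : 0 <= C -> C <= C0 + C1 -> c * C <= 1.
  by move=> Cg CC; rewrite mulrC ler_pdivrMr ?mul1r; lra.
exists F; split.
- by move=> n; exact: (BF n).2.
- by move=> n t; apply: bump_span_supp => //; exact: (BF n).1.
- move=> t; rewrite /F derive1n0 /f; congr (_ * _).
  by rewrite mulrC !mulNr opprK.
- split=> t.
    rewrite /F derive1n0; apply/andP; split.
      by rewrite mulr_ge0 ?(ltW c0) // /f mulr_ge0 ?expinv_ge0.
    apply: le_trans (cle C0 C0ge _); last by lra.
    by rewrite ler_pM2l // (le_trans (ler_norm _)).
  rewrite F1 normrM (gtr0_norm c0).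
  apply: le_trans (cle C1 C1ge _); last by lra.
  by rewrite ler_pM2l.
- split.
    have [C C_ge FC] := bump_span_bounded (BF 2%N).1.
    by exists (C + 1); [rewrite ltr_pwDr | move=> t; rewrite (le_trans (FC t)) // lerDl].
  exists (c * (expR (- 2) * expR (- 2))); first by rewrite !mulr_gt0 ?expR_gt0.
  move=> t ta; rewrite /F derive1n0 ler_pM2l //.
  have tb : `|t / a| <= 2^-1.
    by rewrite normrM normfV (gtr0_norm a0) ler_pdivrMr // mulrC.
  have e2 s : 2^-1 <= s -> expR (- 2) <= expinv 0 s.
    move=> s2; have s0 : 0 < s by lra.
    rewrite /expinv s0 expr0 invr1 mul1r ler_expR lerN2.
    by rewrite -[leRHS]invrK lef_pV2 // posrE.
  move: tb; rewrite ler_norml => /andP[tb1 tb2].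
  by rewrite /f ler_pM ?expR_ge0 // e2 //; lra.
Qed.

End Bump.

(** * The averaging kernel on d-dimensional space *)

Section TestFunction.
Set Implicit Arguments.
Unset Strict Implicit.
Unset Printing Implicit Defensive.
Local Open Scope classical_set_scope.
Local Open Scope ring_scope.
Import numFieldNormedType.Exports.
Context {R : realType}.

Lemma is_derive_continuous (f g : R -> R) :
  (forall t : R, is_derive t 1 f (g t)) -> continuous f.
Proof.
move=> fg t; apply: differentiable_continuous; apply/derivable1_diffP.
exact: ex_derive.
Qed.

Lemma is_derive_mean_value (f g : R -> R) (a b : R) :
  (forall t : R, is_derive t 1 f (g t)) -> a <= b ->
  exists c, a <= c <= b /\ f b - f a = g c * (b - a).
Proof.
move=> fg ab; have [|c] := MVT_segment ab (fun t _ => fg t).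
  by apply: continuous_subspaceT; exact: is_derive_continuous fg.
by rewrite in_itv /= => cab ->; exists c.
Qed.

(** The mean value theorem writes the two first differences as derivatives at points [e <= c] at
    most [2 * s] apart; applied once more, to [g] between them, it gives the factor 2. *)
Lemma second_difference_le (f g h : R -> R) (C : R) :
  (forall t : R, is_derive t 1 f (g t)) -> (forall t : R, is_derive t 1 g (h t)) ->
  (forall t, `|h t| <= C) ->
  forall t s, `|f (t + s) + f (t - s) - 2 * f t| <= 2 * C * s ^+ 2.
Proof.
move=> fg gh hC.
have C0 : 0 <= C := le_trans (normr_ge0 _) (hC 0).
have pos t s : 0 <= s -> `|f (t + s) + f (t - s) - 2 * f t| <= 2 * C * s ^+ 2.
  move=> s0.
  have [c [/andP[c1 c2] fc]] : exists c, t <= c <= t + s /\ f (t + s) - f t = g c * (t + s - t).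
    by apply: is_derive_mean_value => //; rewrite lerDl.
  have [e [/andP[e1 e2] fe]] : exists c, t - s <= c <= t /\ f t - f (t - s) = g c * (t - (t - s)).
    by apply: is_derive_mean_value => //; rewrite gerBl.
  have [w [_ gw]] : exists w, e <= w <= c /\ g c - g e = h w * (c - e).
    by apply: is_derive_mean_value => //; exact: le_trans c1.
  have -> : f (t + s) + f (t - s) - 2 * f t = h w * ((c - e) * s).
    rewrite mulrA -gw mulrBl.
    have -> : g c * s = f (t + s) - f t by rewrite fc; ring.
    have -> : g e * s = f t - f (t - s) by rewrite fe; ring.
    by ring.
  rewrite normrM [2 * C]mulrC -mulrA ler_pM //.
  have ce : 0 <= c - e by lra.
  rewrite normrM (ger0_norm s0) (ger0_norm ce) expr2 mulrA ler_wpM2r //; lra.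
move=> t s; have [s0|s0] := leP 0 s; first exact: pos.
have := pos t (- s); rewrite opprK sqrrN [f (t - s) + _]addrC; apply; lra.
Qed.

Lemma is_derive_line (d : nat) (f : 'rV[R]_d -> R) (x v : 'rV[R]_d) (g : R -> R) (t l : R) :
  (forall h, f (h *: v + x) = g (h + t)) -> is_derive t 1 g l -> is_derive x v f l.
Proof.
move=> fg [dg gl].
have E : (fun h : R => h^-1 *: ((f \o shift x) (h *: v) - f x)) =
         (fun h : R => h^-1 *: ((g \o shift t) (h *: (1 : R)) - g t)).
  apply/funext => h; rewrite /= fg (_ : h%:A = h); last exact: mulr1.
  by have := fg 0; rewrite scale0r !add0r => ->.
by split; rewrite /derivable /derive E.
Qed.

Lemma prodr_itv01_le1 (I : finType) (P : pred I) (f : I -> R) :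
  (forall i, P i -> 0 <= f i <= 1) -> \prod_(i | P i) f i <= 1.
Proof.
move=> f01; apply: (@le_trans _ _ (\prod_(i | P i) 1)); last by rewrite big1.
exact: ler_prod.
Qed.

Lemma continuous_prod_coord (d : nat) (f : 'I_d -> R -> R) (r : seq 'I_d) :
  (forall i, continuous (f i)) ->
  continuous (fun x : 'rV[R]_d => \prod_(i <- r) f i (x 0 i)).
Proof.
move=> cf; elim: r => [|i r IH] x.
  rewrite (_ : (fun _ => _) = (fun=> 1 : R)); last by apply/funext => y; rewrite big_nil.
  exact: cst_continuous.
rewrite (_ : (fun _ => _) =
   (fun y : 'rV[R]_d => f i (y 0 i) * \prod_(j <- r) f j (y 0 j))); last first.
  by apply/funext => y; rewrite big_cons.
have ci : (fun y : 'rV[R]_d => f i (y 0 i)) @ x --> f i (x 0 i).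
  exact: (cvg_comp _ _ (@coord_continuous _ _ _ _ _ x) (cf i (x 0 i))).
exact: (cvgM ci (IH x)).
Qed.

(** Evenness makes averages reproduce affine functions, the second difference bound controls the
    Laplacian of the kernel, and the lower bound near the origin controls its mass. The order in
    [testfun 1] is the one attached to the exponent [eta - 2], which lies between -1 and 0. *)
Record mollifier (d : nat) (phi : 'rV[R]_d -> R) (C a c : R) : Prop := Mollifier {
  mollifier_testfun : testfun 1 phi;
  mollifier_even : forall x : 'rV[R]_d, phi (- x) = phi x;
  mollifier_itv01 : forall x, 0 <= phi x <= 1;
  mollifier_supp : forall x : 'rV[R]_d, 1 <= l1dist x 0 -> phi x = 0;
  mollifier_diff2 : forall (x : 'rV[R]_d) j (h : R),
    `|phi (x + h *: delta_mx 0 j) + phi (x - h *: delta_mx 0 j) - 2 * phi x| <= C * h ^+ 2;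
  mollifier_cst : [/\ 0 < C, 0 < a, a <= 1 & 0 < c];
  mollifier_lower : forall x : 'rV[R]_d, (forall i, `|x 0 i| <= a) -> c <= phi x }.

Lemma mollifier_exists (d : nat) :
  exists (phi : 'rV[R]_d -> R) (C a c : R), mollifier phi C a c.
Proof.
(* With this radius per coordinate the closed support cube lies in the open unit ball, since
   [d / (d + 1) < 1]. *)
pose a : R := d.+1%:R^-1.
have a0 : 0 < a by rewrite invr_gt0.
have a1 : a <= 1 by rewrite invf_le1 // ler1n.
have [th [dth tha thN [th01 th1] [[C C0 th2] [c c0 thc]]]] := bump1_exists a0.
pose F (n : 'I_d -> nat) (x : 'rV[R]_d) := \prod_i th (n i) (x 0 i).
have Fline n (x : 'rV[R]_d) j h :
    F n (h *: delta_mx 0 j + x) = th (n j) (h + x 0 j) * \prod_(i | i != j) th (n i) (x 0 i).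
  rewrite /F (bigD1 j) //= !mxE !eqxx mulr1; congr (_ * _).
  apply: eq_bigr => i ij; congr (th _ _).
  by rewrite !mxE eqxx /= (negbTE ij) mulr0 add0r.
have Fx n (x : 'rV[R]_d) j :
    F n x = th (n j) (x 0 j) * \prod_(i | i != j) th (n i) (x 0 i).
  by have := Fline n x j 0; rewrite scale0r !add0r.
have dF n (x : 'rV[R]_d) j :
    is_derive x (delta_mx 0 j) (F n) (F (fun i => (n i + (i == j))%N) x).
  pose p := \prod_(i | i != j) th (n i) (x 0 i).
  apply: (@is_derive_line _ _ _ _ (fun t => p * th (n j) t) (x 0 j)).
    by move=> h; rewrite Fline mulrC.
  have := @is_deriveZ _ _ _ (th (n j)) p (x 0 j) 1 _ (dth (n j) (x 0 j)).
  move=> D; apply: is_derive_eq D _.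
  rewrite (Fx _ _ j) /GRing.scale /= mulrC eqxx addn1; congr (_ * _).
  by apply: eq_bigr => i /negbTE ->; rewrite addn0.
(* Here [n i] counts the occurrences of [i] in [s]. A list of length at most one thus involves only
   [th 0] and [th 1], both bounded by one. *)
have pF s : exists n, pder s (F (fun=> 0%N)) = F n /\ (forall i, n i = count_mem i s).
  elim: s => [|j s [n [En nE]]]; first by exists (fun=> 0%N).
  exists (fun i => (n i + (i == j))%N); split.
    rewrite /= En; apply/funext => x; rewrite /partial.
    by have [_ ->] := dF n x j.
  by move=> i; rewrite nE /= addnC eq_sym.
have cF n : continuous (F n).
  have cth m : continuous (th m) := is_derive_continuous (dth m).
  exact: (@continuous_prod_coord d (fun i => th (n i)) _ (fun i => cth (n i))).
have Fle n x : (forall i, n i <= 1)%N -> `|F n x| <= 1.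
  move=> n1; rewrite /F normr_prod; apply: prodr_itv01_le1 => i _.
  rewrite normr_ge0 /=; have := n1 i; case: (n i) => [|[|]] // _.
  by have /andP[t0 t1] := th01 (x 0 i); rewrite ger0_norm.
have l1a (x : 'rV[R]_d) : (forall i, `|x 0 i| <= a) -> l1dist x 0 < 1.
  move=> xa; apply: (@le_lt_trans _ _ (\sum_(i < d) a)).
    by apply: ler_sum => i _; rewrite mxE subr0.
  by rewrite sumr_const card_ord -mulr_natl /a ltr_pdivrMr // mul1r ltr_nat.
have F0 (x : 'rV[R]_d) i : a <= `|x 0 i| -> F (fun=> 0%N) x = 0.
  by move=> ai; rewrite (Fx _ _ i) tha ?mul0r.
exists (F (fun=> 0%N)), (2 * C), (a / 2), (c ^+ d); split.
- split; [|split].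
  + by move=> s; have [n [-> _]] := pF s; split => // j x; exact: ex_derive.
  + move=> x clx.
    have xa i : `|x 0 i| <= a.
      rewrite leNgt; apply/negP => axi.
      have cx : (fun y : 'rV[R]_d => `|y 0 i|) @ x --> `|x 0 i|.
        exact: (cvg_norm (@coord_continuous _ _ _ _ _ x)).
      have /clx [y [/= yF ya]] : nbhs x [set y : 'rV[R]_d | a < `|y 0 i|].
        exact: cvgr_gt cx _ axi.
      by move: yF; rewrite (F0 y i (ltW ya)) eqxx.
    exact: l1a.
  + move=> s s1 x; have [n [-> nE]] := pF s.
    by apply: Fle => i; rewrite nE (leq_trans (count_size _ _)).
- by move=> x; apply: eq_bigr => i _; rewrite mxE thN.
- move=> x.
  have := Fle (fun=> 0%N) x (fun=> isT).
  have F_ge0 : 0 <= F (fun=> 0%N) x.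
    by apply: prodr_ge0 => i _; have /andP[] := th01 (x 0 i).
  by rewrite F_ge0 ger0_norm.
- move=> x x1; have [[i xi]|nx] := pselect (exists i, a <= `|x 0 i|); first exact: F0 xi.
  suff : l1dist x 0 < 1 by rewrite ltNge x1.
  apply: l1a => i.
  by rewrite leNgt; apply/negP => ai; apply: nx; exists i; exact: ltW.
- move=> x j h; rewrite addrC [x - _]addrC addrC -scaleNr [x + _]addrC !Fline (Fx _ _ j).
  rewrite mulrA -mulrDl -mulrBl normrM.
  have p1 : `|\prod_(i | i != j) th 0%N (x 0 i)| <= 1.
    rewrite normr_prod; apply: prodr_itv01_le1 => i _.
    by have /andP[t0 t1] := th01 (x 0 i); rewrite ger0_norm ?t0.
  rewrite -[leRHS]mulr1 ler_pM //.
  have := second_difference_le (dth 0%N) (dth 1%N) th2 (x 0 j) h.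
  by rewrite [- h + _]addrC [h + _]addrC.
- split; [exact: mulr_gt0 | exact: divr_gt0 | lra | exact: exprn_gt0].
- move=> x xa; rewrite /F -[leLHS](_ : \prod_(i < d) c = _); last by rewrite prodr_const card_ord.
  apply: ler_prod => i _; rewrite (ltW c0) /=; exact: thc.
Qed.

End TestFunction.

(** * The lattice Laplacian and the interior gradient estimate *)

Section Lattice.
Set Implicit Arguments.
Unset Strict Implicit.
Unset Printing Implicit Defensive.
Local Open Scope ring_scope.
Context {R : realType} {d : nat}.
Local Notation L := 'rV[int]_d.
Local Notation "''e_' j" := (delta_mx 0 j : L) (at level 8, j at level 2, format "''e_' j").
Implicit Types (z p : L) (g h : L -> R) (n m : nat) (i j : 'I_d).

Definition lap g z : R := \sum_j (g (z + 'e_j) + g (z - 'e_j) - 2 * g z).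

Definition box_point n (k : {ffun 'I_d -> 'I_n.*2.+1}) : L :=
  \row_i ((k i : nat)%:Z - n%:Z).

Definition box n : seq L := [seq box_point k | k : {ffun 'I_d -> 'I_n.*2.+1}].

Lemma mem_box n z : (z \in box n) = [forall i, (absz (z 0%R i) <= n)%N].
Proof.
apply/mapP/forallP => [[k _ ->] i|zn].
  rewrite /box_point mxE; have := ltn_ord (k i); move: (nat_of_ord (k i)) => q; lia.
exists [ffun i => inord (absz (z 0%R i + n%:Z)%R)]; first by rewrite mem_enum.
apply/rowP => i; rewrite /box_point mxE ffunE.
by rewrite inordK; have := zn i; move: (z 0 i) => q; lia.
Qed.

Lemma box_uniq n : uniq (box n).
Proof.
rewrite map_inj_uniq ?enum_uniq // => k l /rowP kl.
by apply/ffunP => i; apply/val_inj; have := kl i; rewrite !mxE /=; lia.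
Qed.

Lemma size_box n : size (box n) = (n.*2.+1 ^ d)%N.
Proof. by rewrite size_map -cardE card_ffun !card_ord. Qed.

Lemma seq_max_exists (T : eqType) (f : T -> R) (s : seq T) x : x \in s ->
  exists2 m, m \in s & forall y, y \in s -> f y <= f m.
Proof.
elim: s x => // y s IH x _; case: s IH => [_|z s IH].
  by exists y; rewrite ?mem_head // => u; rewrite inE => /eqP ->.
have [m ms fm] := IH z (mem_head _ _).
have [ym|my] := leP (f y) (f m).
  exists m; first by rewrite inE ms orbT.
  by move=> u; rewrite inE => /orP[/eqP -> //|]; exact: fm.
exists y; first exact: mem_head.
move=> u; rewrite inE => /orP[/eqP -> //|us].
by apply: le_trans (fm u us) (ltW my).
Qed.

Lemma coordDe z i j : (z + 'e_j) 0 i = z 0 i + (i == j)%:R.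
Proof. by rewrite !mxE eqxx. Qed.

Lemma coordBe z i j : (z - 'e_j) 0 i = z 0 i - (i == j)%:R.
Proof. by rewrite !mxE eqxx. Qed.

Lemma sum_coordDe (b : 'I_d -> int -> R) z j :
  \sum_i b i ((z + 'e_j) 0 i) = \sum_i b i (z 0 i) + (b j (z 0 j + 1) - b j (z 0 j)).
Proof.
rewrite (bigD1 j) // [in RHS](bigD1 j) //= coordDe eqxx.
rewrite (eq_bigr (fun i => b i (z 0 i))); first by ring.
by move=> i /negbTE ij; rewrite coordDe ij addr0.
Qed.

Lemma sum_coordBe (b : 'I_d -> int -> R) z j :
  \sum_i b i ((z - 'e_j) 0 i) = \sum_i b i (z 0 i) + (b j (z 0 j - 1) - b j (z 0 j)).
Proof.
rewrite (bigD1 j) // [in RHS](bigD1 j) //= coordBe eqxx.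
rewrite (eq_bigr (fun i => b i (z 0 i))); first by ring.
by move=> i /negbTE ij; rewrite coordBe ij subr0.
Qed.

(** The mirror at height one half contains no lattice point and swaps [0] with ['e_j]. The discrete
    gradient [h 'e_j - h 0] is therefore exactly a value of the odd difference of [h] and its
    reflection. *)
Definition reflect_half j z : L := \row_i (if i == j then 1 - z 0 i else z 0 i).

Lemma reflect_half_addl j z : reflect_half j (z + 'e_j) = reflect_half j z - 'e_j.
Proof.
apply/rowP => i; rewrite coordBe !mxE eqxx /=.
by case: eqP => //= _; lia.
Qed.

Lemma reflect_half_subl j z : reflect_half j (z - 'e_j) = reflect_half j z + 'e_j.
Proof.
apply/rowP => i; rewrite coordDe !mxE eqxx /=.
by case: eqP => //= _; lia.
Qed.

Lemma reflect_half_addr i j z : i != j -> reflect_half j (z + 'e_i) = reflect_half j z + 'e_i.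
Proof.
move=> ij; apply/rowP => k; rewrite coordDe !mxE eqxx /=.
by case: (eqVneq k j) => [->|//]; rewrite eq_sym (negbTE ij) !addr0.
Qed.

Lemma reflect_half_subr i j z : i != j -> reflect_half j (z - 'e_i) = reflect_half j z - 'e_i.
Proof.
move=> ij; apply/rowP => k; rewrite coordBe !mxE eqxx /=.
by case: (eqVneq k j) => [->|//]; rewrite eq_sym (negbTE ij) !subr0.
Qed.

Lemma lap_reflect_half h j z :
  lap (fun y => h y - h (reflect_half j y)) z = lap h z - lap h (reflect_half j z).
Proof.
rewrite /lap -sumrB; apply: eq_bigr => i _.
have [->|ij] := eqVneq i j; first by rewrite reflect_half_addl reflect_half_subl; ring.
by rewrite reflect_half_addr // reflect_half_subr //; ring.
Qed.

(* Reflection principle: [w z = h z - h (reflect_half j z)] is odd across the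
   hyperplane [z_j = 1/2]; on the half box it is dominated by the
   superharmonic barrier [a Q + c (t (2n + 1 - t) + 1) + g t], where
   [t = 2 z_j - 1] and [Q] is the sum of the squares of the other coordinates. *)
Lemma gradient_upper_bound h j n (H f : R) : (0 < n)%N -> 0 < H ->
  (forall z, z \in box n -> `|h z| <= H) ->
  (forall z, z \in box n -> `|lap h z| <= f) ->
  h 'e_j - h 0 <= (2 * d%:R + 4) * (H / n%:R + n%:R * f).
Proof.
move=> n0 H0 hH hf.
have N0 : 0 < n%:R :> R by rewrite ltr0n.
have N1 : 1 <= n%:R :> R by rewrite ler1n.
have box0 : (0 : L) \in box n by rewrite mem_box; apply/forallP => i; rewrite mxE.
have f0 : 0 <= f := le_trans (normr_ge0 _) (hf _ box0).
(* [a] makes the barrier reach [2 * H] on the lateral faces, [g] does so on the top face because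
   [2 n - 1 >= n], and [c] brings the Laplacian of the barrier down to at most [- 2 * a - 2 * f]. *)
pose a : R := 2 * H / n%:R ^+ 2.
have a0 : 0 < a by rewrite divr_gt0 ?exprn_gt0 // mulr_gt0.
pose c : R := (a * (d%:R + 1) + f) / 4.
have c0 : 0 <= c by rewrite divr_ge0 // addr_ge0 // mulr_ge0 // ltW.
pose g : R := 2 * H / n%:R.
have g0 : 0 < g by rewrite divr_gt0 // mulr_gt0.
pose T : R := 2 * n%:R + 1.
pose bt (s : R) := c * ((2 * s - 1) * (T - (2 * s - 1)) + 1) + g * (2 * s - 1).
pose b i (s : int) : R := if i == j then bt s%:~R else a * s%:~R ^+ 2.
pose B z := \sum_i b i (z 0 i).
pose w z := h z - h (reflect_half j z).
pose S := [seq z <- box n | 1 <= (z : L) 0 j].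
have SP z : reflect (z \in box n /\ 1 <= z 0 j) (z \in S).
  by rewrite mem_filter andbC; exact: andP.
have boxP z : reflect (forall i, (absz (z 0%R i) <= n)%N) (z \in box n).
  by rewrite mem_box; exact: forallP.
have zjn z i : z \in box n -> -(n%:R) <= (z 0 i)%:~R :> R /\ (z 0 i)%:~R <= n%:R :> R.
  move=> /boxP /(_ i); move: (z 0 i) => q qn.
  by rewrite -[n%:R]mulrz_nat -mulrNz !ler_int; lia.
have bt_ge0 s : 1 <= s -> s <= n%:R -> 0 <= bt s.
  move=> s1 sn; rewrite /bt addr_ge0 //; last by rewrite mulr_ge0 ?(ltW g0) //; lra.
  by rewrite mulr_ge0 // addr_ge0 // mulr_ge0 // /T; lra.
have btE s : bt (s + 1) + bt (s - 1) - 2 * bt s = - (8 * c) by rewrite /bt; ring.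
have b_ge0 z i : z \in S -> 0 <= b i (z 0 i).
  move=> /SP[zb z1]; rewrite /b; case: eqP => [->|_]; last first.
    by rewrite mulr_ge0 ?sqr_ge0 // ltW.
  by apply: bt_ge0; [rewrite ler1z | have [] := zjn z j zb].
have B_ge z i : z \in S -> b i (z 0 i) <= B z.
  move=> zS; rewrite /B (bigD1 i) //= lerDl; apply: sumr_ge0 => k _; exact: b_ge0.
have rS z : z \in S -> reflect_half j z \in box n.
  move=> /SP[/boxP zb z1]; apply/boxP => i; rewrite mxE.
  by case: eqP => [->|_] //; have := zb j; lia.
have wH z : z \in S -> w z <= 2 * H.
  move=> zS; have /SP[zb _] := zS.
  have := hH _ zb; have := hH _ (rS z zS); rewrite !ler_norml /w => /andP[? ?] /andP[? ?].
  by lra.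
(* Maximum principle: a positive maximum of [w - B] on the half box avoids the lateral and top
   faces, where [B >= 2 * H >= w]. Comparing with all neighbours then gives
   [lap w m <= lap B m < - 2 f], while [lap w m >= - 2 f]. *)
have wB z : z \in S -> w z <= B z.
  move=> zS; rewrite leNgt; apply/negP => Bwz.
  have [m [mS mmax]] : exists m : L, m \in S /\ forall y : L, y \in S -> w y - B y <= w m - B m.
    by have [m ? ?] := seq_max_exists (fun y => w y - B y) zS; exists m.
  have mu0 : 0 < w m - B m by apply: lt_le_trans (mmax z zS); rewrite subr_gt0.
  have /SP[/boxP mb m1] := mS.
  have Bm2 : B m < 2 * H by apply: lt_le_trans (wH m mS); lra.
  have mi i : i != j -> (absz (m 0%R i) < n)%N.
    move=> ij; rewrite ltn_neqAle mb andbT; apply/negP => /eqP mn.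
    have := le_lt_trans (B_ge m i mS) Bm2; rewrite /b (negbTE ij) ltNge => /negP; apply.
    have -> : (m 0 i)%:~R ^+ 2 = n%:R ^+ 2 :> R.
      by rewrite -mn natr_absz intr_norm real_normK ?num_real.
    by rewrite /a divfK // expf_neq0 // gt_eqF.
  have mj : (m 0 j < n)%R.
    rewrite lt_neqAle; apply/andP; split; last by move: (mb j) m1; clear; lia.
    apply/negP => /eqP mn.
    have := le_lt_trans (B_ge m j mS) Bm2; rewrite /b eqxx ltNge => /negP; apply.
    rewrite mn /bt; apply: (@le_trans _ _ (g * n%:R)).
      by rewrite /g divfK // gt_eqF.
    rewrite -[leLHS]add0r lerD //.
      by rewrite mulr_ge0 // addr_ge0 // mulr_ge0 // /T; lra.
    by rewrite ler_wpM2l ?(ltW g0) //; lra.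
  have mbD i : m + 'e_i \in box n.
    apply/boxP => k; rewrite coordDe; have [->|ki] := eqVneq k i; last by rewrite addr0.
    rewrite mulr1n; have [->|ij] := eqVneq i j.
      by move: mj m1; move: (m 0 j) => q; clear; lia.
    by move: (mi i ij); move: (m 0 i) => q; clear; lia.
  have mbB i : m - 'e_i \in box n.
    apply/boxP => k; rewrite coordBe; have [->|ki] := eqVneq k i; last by rewrite subr0.
    rewrite mulr1n; have [->|ij] := eqVneq i j.
      by move: mj m1; move: (m 0 j) => q; clear; lia.
    by move: (mi i ij); move: (m 0 i) => q; clear; lia.
  have up i : w (m + 'e_i) - B (m + 'e_i) <= w m - B m.
    apply: mmax; apply/SP; split; first exact: mbD.
    by rewrite coordDe; move: m1; move: (m 0 j) => q; clear; case: (j == i); lia.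
  (* The only neighbour that can leave the half box is the mirror image of [m]. There [w] changes
     sign, and the [+ 1] in [bt] gives [bt 0 = - bt 1], so the comparison reduces to
     [w m >= bt 1]. *)
  have down i : w (m - 'e_i) - B (m - 'e_i) <= w m - B m.
    have [mmS|/SP mnS] := boolP ((m - 'e_i) \in S); first exact: mmax.
    have mi1 : (m - 'e_i) 0 j < 1 by rewrite ltNge; apply/negP => ?; exact: mnS.
    have ij : i = j.
      by apply/eqP/negPn/negP => ij; move: mi1; rewrite coordBe eq_sym (negbTE ij) subr0 ltNge m1.
    have mj1 : m 0 j = 1.
      by move: mi1 m1; rewrite ij coordBe eqxx mulr1n; move: (m 0 j) => q; clear; lia.
    rewrite {}ij {mi1 mnS}.
    have rm : reflect_half j m = m - 'e_j.
      apply/rowP => k; rewrite coordBe mxE; case: eqP => [->|_]; last by rewrite subr0.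
      by rewrite mj1.
    have wm : w (m - 'e_j) = - w m.
      by rewrite /w reflect_half_subl rm subrK opprB.
    rewrite wm {1}/B sum_coordBe -/(B m) mj1 /b eqxx /bt subrr.
    have := B_ge m j mS; rewrite mj1 /b eqxx /bt.
    rewrite mulr0z mulr1z => Bm.
    by rewrite /T in Bm *; lra.
  have lapw : lap w m <= lap B m.
    apply: ler_sum => i _; have := up i; have := down i; lra.
  have lapB : lap B m < - (2 * f).
    rewrite /lap.
    have E i : B (m + 'e_i) + B (m - 'e_i) - 2 * B m <=
                (if i == j then - (8 * c) else 0) + 2 * a.
      rewrite /B sum_coordDe sum_coordBe /b.
      case: eqP => [->|_]; rewrite rmorphB rmorphD /= mulr1z; last by lra.
      by have := btE (m 0 j)%:~R; have := a0; lra.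
    apply: le_lt_trans (ler_sum _ (fun i _ => E i)) _.
    rewrite big_split /= sumr_const card_ord -big_mkcond /= big_pred1_eq -[2 * a *+ d]mulr_natr.
    by rewrite /c; have := a0; lra.
  have := hf _ (rS m mS); have := hf m (introT (boxP m) mb); rewrite !ler_norml.
  move=> /andP[l1 _] /andP[_ l2]; move: lapw; rewrite /w lap_reflect_half; lra.
have ejS : 'e_j \in S.
  apply/SP; split; last by rewrite mxE !eqxx.
  by apply/boxP => i; rewrite mxE; case: (_ && _) => //.
have := wB _ ejS; rewrite /w.
have -> : reflect_half j 'e_j = 0.
  by apply/rowP => i; rewrite !mxE eqxx /=; case: eqP.
move=> /le_trans; apply.
have -> : B 'e_j = c * T + g.
  rewrite /B (bigD1 j) //= big1 ?addr0.
    by rewrite /b eqxx mxE !eqxx /bt mulr1z; ring.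
  by move=> i /negbTE ij; rewrite /b ij mxE ij andbF mulr0z expr0n mulr0.
have -> : c * T + g = (2 * (H / n%:R) * (n%:R * n%:R^-1) * (d%:R + 1) + n%:R * f) / 4 * (2 + n%:R^-1)
    + 2 * (H / n%:R).
  rewrite /c /T /g /a; field.
  by rewrite gt_eqF.
rewrite mulfV ?gt_eqF // mulr1.
have nV : n%:R^-1 <= 1 :> R by rewrite invf_le1.
have nV0 : 0 <= n%:R^-1 :> R by rewrite invr_ge0 ltW.
have Hn : 0 <= H / n%:R by rewrite divr_ge0 // ltW.
have nf : 0 <= n%:R * f by rewrite mulr_ge0 // ltW.
have Hd : 0 <= (H / n%:R) * d%:R by rewrite mulr_ge0.
have nfd : 0 <= (n%:R * f) * d%:R by rewrite mulr_ge0.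
apply: (@le_trans _ _ ((2 * (H / n%:R) * (d%:R + 1) + n%:R * f) / 4 * 3 + 2 * (H / n%:R))); last by nra.
rewrite lerD2r ler_wpM2l //; last by lra.
by rewrite divr_ge0 //; clear -Hn nf Hd; lra.
Qed.

Lemma lap_translate h p z : lap (fun y => h (p + y)) z = lap h (p + z).
Proof. by rewrite /lap; apply: eq_bigr => i _; rewrite !addrA. Qed.

Lemma lapN h z : lap (fun y => - h y) z = - lap h z.
Proof. by rewrite /lap -sumrN; apply: eq_bigr => i _; ring. Qed.

Lemma lapB g h z : lap (fun y => g y - h y) z = lap g z - lap h z.
Proof. by rewrite /lap -sumrB; apply: eq_bigr => i _; ring. Qed.

Lemma gradient_bound h p j n (H f : R) : (0 < n)%N -> 0 < H ->
  (forall z, z \in box n -> `|h (p + z)| <= H) ->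
  (forall z, z \in box n -> `|lap h (p + z)| <= f) ->
  `|h (p + 'e_j) - h p| <= (2 * d%:R + 4) * (H / n%:R + n%:R * f).
Proof.
move=> n0 H0 hH hf; rewrite ler_norml; apply/andP; split; last first.
  have := @gradient_upper_bound (fun y => h (p + y)) j n H f n0 H0 hH.
  by rewrite addr0; apply => z zn; rewrite lap_translate hf.
rewrite lerNl opprB.
have := @gradient_upper_bound (fun y => - h (p + y)) j n H f n0 H0.
rewrite addr0 opprK addrC; apply => z zn; first by rewrite normrN hH.
by rewrite lapN normrN lap_translate hf.
Qed.

Definition norm1 z : nat := \sum_i absz (z 0%R i).

Lemma norm1D z y : (norm1 (z + y) <= norm1 z + norm1 y)%N.
Proof.
rewrite /norm1 -big_split; apply: leq_sum => i _; rewrite mxE.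
by move: (z 0 i) (y 0 i) => q r /=; clear; lia.
Qed.

Lemma norm1N z : norm1 (- z) = norm1 z.
Proof. by rewrite /norm1; apply: eq_bigr => i _; rewrite mxE abszN. Qed.

Lemma norm10 : norm1 0 = 0%N.
Proof. by rewrite /norm1 big1 // => i _; rewrite mxE. Qed.

Lemma norm1_distC z y : norm1 (z - y) = norm1 (y - z).
Proof. by rewrite -norm1N opprB. Qed.

Lemma norm1_e j : norm1 'e_j = 1%N.
Proof.
rewrite /norm1 (bigD1 j) //= big1 ?mxE ?eqxx // => i /negbTE ij.
by rewrite mxE ij andbF.
Qed.

Lemma norm1_eq0 z : norm1 z = 0%N -> z = 0.
Proof.
move=> /eqP; rewrite /norm1 sum_nat_eq0 => /forallP zi.
by apply/rowP => i; rewrite mxE; apply/eqP; rewrite -absz_eq0; exact: zi.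
Qed.

Lemma coord_le_norm1 z i : (absz (z 0%R i) <= norm1 z)%N.
Proof. by rewrite /norm1 (bigD1 i) //= leq_addr. Qed.

Lemma norm1_box n z : z \in box n -> (norm1 z <= d * n)%N.
Proof.
rewrite mem_box => /forallP zn; rewrite /norm1.
have -> : (d * n)%N = (\sum_(i < d) n)%N by rewrite sum_nat_const card_ord.
exact: leq_sum.
Qed.

Lemma norm1_mem_box n z : (norm1 z <= n)%N -> z \in box n.
Proof.
by move=> zn; rewrite mem_box; apply/forallP => i; apply: leq_trans (coord_le_norm1 z i) zn.
Qed.

Lemma norm1_predecessor n z : norm1 z = n.+1 ->
  exists y j, norm1 y = n /\ (z = y + 'e_j \/ z = y - 'e_j).
Proof.
move=> zn; have [j zj] : exists j, z 0 j != 0.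
  have [/existsP //|] := boolP [exists j, z 0 j != 0].
  rewrite negb_exists => /forallP z0.
  suff : norm1 z = 0%N by rewrite zn.
  by rewrite /norm1 big1 // => i _; have := z0 i; rewrite negbK => /eqP ->.
have E (y : L) : (forall i, i != j -> y 0 i = z 0 i) -> (absz (y 0%R j)).+1 = absz (z 0%R j) ->
    norm1 y = n.
  move=> yz yj; apply: succn_inj; rewrite -zn /norm1 (bigD1 j) // [RHS](bigD1 j) //= -yj addSn.
  by congr (_ + _).+1; apply: eq_bigr => i /yz ->.
have [z0|z0] := ltP 0 (z 0 j).
  exists (z - 'e_j), j; split; last by left; rewrite subrK.
  apply: E => [i /negbTE ij|]; first by rewrite coordBe ij subr0.
  by rewrite coordBe eqxx; move: z0; move: (z 0 j) => q; clear; lia.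
exists (z + 'e_j), j; split; last by right; rewrite addrK.
apply: E => [i /negbTE ij|]; first by rewrite coordDe ij addr0.
by rewrite coordDe eqxx; move: z0 zj; move: (z 0 j) => q; clear; lia.
Qed.

(** Telescoping along a shortest lattice path from [p] to [p + b], which stays in the ball where the
    gradient is controlled. *)
Lemma increment_bound g x (D : R) (rho : nat) :
  (forall p j, (norm1 (p - x) <= rho)%N -> `|g (p + 'e_j) - g p| <= D) ->
  forall p b, (norm1 (p - x) + norm1 b <= rho)%N -> `|g (p + b) - g p| <= (norm1 b)%:R * D.
Proof.
move=> gD p b; move En : (norm1 b) => n; elim: n b En => [|n IH] b bn pn.
  by rewrite (norm1_eq0 bn) addr0 subrr normr0 mul0r.
have [y [j [yn yb]]] := norm1_predecessor bn.
have st : `|g (p + b) - g (p + y)| <= D.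
  case: yb => by_; rewrite by_ addrA; last rewrite distrC -{1}[p + y](subrK 'e_j); apply: gD.
    rewrite addrAC; apply: leq_trans (norm1D _ _) _; rewrite yn; apply: leq_trans pn.
    by rewrite leq_add2l leqnSn.
  by rewrite -(addrA p) -by_ addrAC; apply: leq_trans (norm1D _ _) _; rewrite bn.
have -> : g (p + b) - g p = (g (p + b) - g (p + y)) + (g (p + y) - g p) by ring.
apply: le_trans (ler_normD _ _) _; rewrite -natr1 mulrDl mul1r addrC lerD //.
by apply: IH => //; apply: leq_trans pn; rewrite leq_add2l leqnSn.
Qed.

End Lattice.

(** * Second increments and almost additive functions *)

Section Increments.
Set Implicit Arguments.
Unset Strict Implicit.
Unset Printing Implicit Defensive.
Local Open Scope ring_scope.
Context {R : realType} {d : nat}.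
Local Notation L := 'rV[int]_d.
Local Notation "''e_' j" := (delta_mx 0 j : L) (at level 8, j at level 2, format "''e_' j").

(** The gradient bound is used twice on boxes of size [n = K * r]: on [v], so that increments by [b]
    are of order [H / K], and then on these increments, which gains a second [1 / K]. Each box costs
    [d * n] in [norm1] and each shift at most [n], whence the radius [(2 * d + 2) * n]. *)
Lemma second_increment_bound (v : L -> R) (x : L) (r K : nat) (H f : R) :
  (0 < r)%N -> (0 < K)%N -> 0 < H ->
  (forall z, (norm1 (z - x) <= (2 * d + 2) * (K * r))%N -> `|v z| <= H) ->
  (forall z, (norm1 (z - x) <= (2 * d + 2) * (K * r))%N -> `|lap v z| <= f) ->
  forall a b, (norm1 a <= r)%N -> (norm1 b <= r)%N ->
  `|(v (x + a + b) - v (x + a)) - (v (x + b) - v x)| <=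
    (2 * d%:R + 4) ^+ 2 * (H / K%:R ^+ 2 + r%:R ^+ 2 * f) +
    (2 * d%:R + 4) * 2 * K%:R * (r%:R ^+ 2 * f).
Proof.
move=> r0 K0 H0 vH vf a b ar br.
set n := (K * r)%N; have n0 : (0 < n)%N by rewrite muln_gt0 K0.
have rn : (r <= n)%N by rewrite leq_pmull.
have [R0 KR0 N0] : [/\ 0 < r%:R :> R, 0 < K%:R :> R & 0 < n%:R :> R] by rewrite !ltr0n.
set Cg : R := 2 * d%:R + 4.
have Cg0 : 0 < Cg by rewrite ltr_pwDr // mulr_ge0.
have f0 : 0 <= f by apply: le_trans (normr_ge0 _) (vf x _); rewrite subrr norm10.
have near_box p z k : (norm1 (p - x) <= k * n)%N -> z \in box n ->
    (norm1 (p + z - x) <= (k + d) * n)%N.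
  move=> pk /norm1_box zn; rewrite addrAC mulnDl.
  by apply: leq_trans (norm1D _ _) _; exact: leq_add.
pose D1 : R := Cg * (H / n%:R + n%:R * f).
have D10 : 0 < D1 by rewrite mulr_gt0 // ltr_pwDl ?divr_gt0 // mulr_ge0 // ltW.
have vD1 p j : (norm1 (p - x) <= (d + 2) * n)%N -> `|v (p + 'e_j) - v p| <= D1.
  move=> pn; apply: gradient_bound => // z zn.
    apply: vH; apply: leq_trans (near_box _ _ _ pn zn) _.
    by rewrite leq_mul2r; apply/orP; right; clear; lia.
  apply: vf; apply: leq_trans (near_box _ _ _ pn zn) _.
  by rewrite leq_mul2r; apply/orP; right; clear; lia.
have vinc p : (norm1 (p - x) <= (d + 1) * n)%N -> `|v (p + b) - v p| <= r%:R * D1.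
  move=> pn; apply: (@le_trans _ _ ((norm1 b)%:R * D1)).
    apply: increment_bound vD1 _ _ _; have -> : ((d + 2) * n = (d + 1) * n + n)%N.
      by rewrite -[in RHS](mul1n n) mulnA muln1 -mulnDl -addnA.
    by rewrite leq_add // (leq_trans br).
  by rewrite ler_pM2r // ler_nat.
pose h z := v (z + b) - v z.
have laph z : lap h z = lap v (z + b) - lap v z.
  rewrite /h lapB; congr (_ - _); rewrite /lap; apply: eq_bigr => i _.
  by rewrite (addrAC z) [z - _ + b]addrAC.
have hD p j : (norm1 (p - x) <= r)%N ->
    `|h (p + 'e_j) - h p| <= Cg * (r%:R * D1 / n%:R + n%:R * (2 * f)).
  move=> pr; have pn : (norm1 (p - x) <= 1 * n)%N by rewrite mul1n (leq_trans pr).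
  apply: gradient_bound => //; first by rewrite mulr_gt0.
    by move=> z zn; apply: vinc; rewrite addnC; exact: near_box.
  move=> z zn; rewrite laph; apply: le_trans (ler_normB _ _) _.
  have -> : 2 * f = f + f by ring.
  have zx := near_box _ _ _ pn zn.
  apply: lerD; apply: vf; last first.
    by apply: leq_trans zx _; rewrite leq_mul2r; apply/orP; right; clear; lia.
  rewrite addrAC; apply: leq_trans (norm1D _ _) _.
  apply: leq_trans (leq_add zx (leq_trans br rn)) _.
  rewrite -[X in (_ + X)%N]mul1n -mulnDl leq_mul2r; apply/orP; right; clear; lia.
have := increment_bound hD (p := x) (b := a).
rewrite subrr norm10 add0n => /(_ ar); rewrite /h => E.
apply: le_trans E _.
apply: (@le_trans _ _ (r%:R * (Cg * (r%:R * D1 / n%:R + n%:R * (2 * f))))).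
  rewrite ler_wpM2r ?ler_nat // mulr_ge0 ?(ltW Cg0) // addr_ge0 //.
    by rewrite divr_ge0 // mulr_ge0 // ltW.
  by rewrite mulr_ge0 // mulr_ge0.
rewrite le_eqVlt; apply/orP; left; apply/eqP.
rewrite /D1 /n natrM; field.
by rewrite !gt_eqF.
Qed.

Lemma norm1_scale_e (q : int) (j : 'I_d) : norm1 (q *: 'e_j) = absz q.
Proof.
rewrite /norm1 (bigD1 j) //= big1 ?mxE ?eqxx ?mulr1 ?addn0 //.
by move=> i /negbTE ij; rewrite mxE mxE ij andbF mulr0.
Qed.

(** On a positive half-axis [b] is reached in at most [r %/ s + 1] steps of length [s], each costing
    [g + G]. A sign change costs one more [G], because [F 0 = 0], and so does each coordinate that
    is added. *)
Lemma additive_bootstrap (F : L -> R) (r s : nat) (g G : R) :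
  (0 < s)%N -> F 0 = 0 ->
  (forall a b, (norm1 a <= r)%N -> (norm1 b <= r)%N -> `|F (a + b) - F a - F b| <= G) ->
  (forall j t, (t <= s)%N -> (t <= r)%N -> `|F (t%:Z *: 'e_j)| <= g) ->
  forall b, (norm1 b <= r)%N ->
  `|F b| <= d%:R * (((r %/ s)%N%:R + 1) * (g + G) + 2 * G).
Proof.
move=> s0 F0 FD Fs.
have G0 : 0 <= G by apply: le_trans (normr_ge0 _) (FD 0 0 _ _); rewrite norm10.
have FDle a b : (norm1 a <= r)%N -> (norm1 b <= r)%N -> `|F (a + b)| <= `|F a| + `|F b| + G.
  move=> ar br; have -> : F (a + b) = F a + F b + (F (a + b) - F a - F b) by ring.
  by rewrite (le_trans (ler_normD _ _)) // lerD ?FD // ler_normD.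
(* Without an axis the hypothesis [Fs] is empty and does not give [0 <= g]; dimension zero is
   settled directly. *)
case: (posnP d) => [d0|d0].
  move=> b _; have -> : b = 0.
    by apply/rowP => i; have := leq_trans (ltn_ord i) (eq_leq d0).
  by rewrite F0 normr0 d0 mul0r.
have g0 : 0 <= g by apply: le_trans (normr_ge0 _) (Fs (Ordinal d0) 0%N _ _).
have Fpos j k m : (m <= r)%N -> (m <= k.+1 * s)%N ->
    `|F (m%:Z *: 'e_j)| <= k.+1%:R * (g + G).
  elim: k m => [|k IH] m mr; rewrite ?mul1n => mk.
    by rewrite mul1r; apply: le_trans (Fs _ _ mk mr) _; rewrite lerDl.
  have [ms|sm] := leqP m s.
    apply: le_trans (Fs _ _ ms mr) _.
    by rewrite -[leLHS]mul1r ler_pM // ?ler1n // lerDl.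
  have -> : m%:Z *: 'e_j = ((m - s)%N%:Z *: 'e_j : L) + s%:Z *: 'e_j.
    by rewrite -scalerDl -PoszD subnK // ltnW.
  apply: le_trans (FDle _ _ _ _) _; rewrite ?norm1_scale_e /=.
  - by rewrite (leq_trans (leq_subr _ _)).
  - by rewrite (leq_trans (ltnW sm)).
  - rewrite -[k.+2%:R]natr1 mulrDl mul1r -addrA lerD //; last first.
      by rewrite lerD // Fs // (leq_trans (ltnW sm)).
    apply: IH; first by rewrite (leq_trans (leq_subr _ _)).
    by rewrite leq_subLR -mulSn.
set X : R := _ * (g + G).
have Fint j (q : int) : (absz q <= r)%N -> `|F (q *: 'e_j)| <= X + G.
  have pos m : (m <= r)%N -> `|F (m%:Z *: 'e_j)| <= X.
    move=> mr; rewrite /X natr1; apply: Fpos => //.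
    by apply: leq_trans mr _; rewrite ltnW // ltn_ceil.
  case: q => m mr; first by apply: le_trans (pos m mr) _; rewrite lerDl.
  rewrite NegzE; have := FD (m.+1%:Z *: 'e_j) (- m.+1%:Z *: 'e_j).
  rewrite -scalerDl subrr scale0r F0 sub0r !norm1_scale_e abszN => /(_ mr mr) E.
  have {}E : `|F (m.+1%:Z *: 'e_j) + F (- m.+1%:Z *: 'e_j)| <= G.
    by rewrite -normrN opprD.
  have -> : F (- m.+1%:Z *: 'e_j) =
    (F (m.+1%:Z *: 'e_j) + F (- m.+1%:Z *: 'e_j)) - F (m.+1%:Z *: 'e_j) by ring.
  by apply: le_trans (ler_normB _ _) _; rewrite addrC lerD // pos.
(* [tr m] keeps the first [m] coordinates of [b]; the induction adds one axis at a time and never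
   leaves the ball of radius [r]. *)
move=> b br; pose tr m : L := \row_i (if (i < m)%N then b 0 i else 0).
have tr_r m : (norm1 (tr m) <= r)%N.
  apply: leq_trans br; rewrite /norm1; apply: leq_sum => i _; rewrite mxE.
  by case: ifP.
have trd : tr d = b by apply/rowP => i; rewrite mxE ltn_ord.
suff E m : (m <= d)%N -> `|F (tr m)| <= m%:R * (X + 2 * G) by rewrite -trd E.
elim: m => [_|m IH md].
  by rewrite mul0r (_ : tr 0%N = 0) ?F0 ?normr0 //; apply/rowP => i; rewrite !mxE.
pose j := Ordinal md.
have -> : tr m.+1 = tr m + b 0 j *: 'e_j.
  apply/rowP => i; rewrite !mxE eqxx /= ltnS leq_eqVlt.
  have [->|ij] := eqVneq i j; first by rewrite /= eqxx ltnn add0r mulr1.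
  by rewrite mulr0 addr0; move: ij; rewrite -val_eqE /= => /negbTE ->.
have bj : (absz (b 0%R j) <= r)%N := leq_trans (coord_le_norm1 b j) br.
apply: le_trans (FDle _ _ _ _) _ => //; first by rewrite norm1_scale_e.
rewrite -natr1 mulrDl mul1r -addrA lerD //; first exact: IH (ltnW md).
have := Fint j _ bj; rewrite -/X; lra.
Qed.

End Increments.

(** * Averaging lattice functions against the kernel *)

Section Mollification.
Set Implicit Arguments.
Unset Strict Implicit.
Unset Printing Implicit Defensive.
Local Open Scope ring_scope.
Context {R : realType} {d : nat}.
Local Notation L := 'rV[int]_d.
Local Notation "''e_' j" := (delta_mx 0 j : L) (at level 8, j at level 2, format "''e_' j").

Implicit Types (w y z : L).

Lemma sum_box_fsbig (V : nmodType) (f : L -> V) N :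
  (forall w, w \notin box N -> f w = 0) ->
  \sum_(w <- box N) f w = \sum_(w \in [set: L]%classic) f w.
Proof.
move=> f0; rewrite (@fsbigE _ _ _ _ _ (box N)) ?box_uniq //; last by move=> w _; exact: f0.
by apply: eq_bigl => w; rewrite in_setT.
Qed.

(** The box need not be invariant under [h]: both summands vanish outside it, so both sums can be
    read over the whole lattice, where [h] is a bijection. *)
Lemma sum_box_reindex (V : nmodType) (f : L -> V) (h h' : L -> L) N :
  cancel h h' -> cancel h' h ->
  (forall w, w \notin box N -> f w = 0) -> (forall w, w \notin box N -> f (h w) = 0) ->
  \sum_(w <- box N) f (h w) = \sum_(w <- box N) f w.
Proof.
move=> hK h'K f0 fh0; rewrite !sum_box_fsbig //; symmetry.
by apply: (@reindex_fsbigT _ _ _ _ _ h); exists h'.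
Qed.

Lemma notin_box N (w : L) : w \notin box N -> (N < norm1 w)%N.
Proof. by apply: contraR; rewrite -leqNgt; exact: norm1_mem_box. Qed.

Definition lattice_weight (phi : 'rV[R]_d -> R) (lam : R) (w : L) : R :=
  phi (lam^-1 *: map_mx (fun q : int => q%:~R) w).

Context (phi : 'rV[R]_d -> R) (C a c : R) (mol : mollifier phi C a c).
(** The lower bound on [N] leaves a margin of one lattice step around the support, as summation by
    parts requires. The upper bound gives [2 * N + 1 <= 7 * lam], hence the size of the box. *)
Context (lam : R) (N : nat) (lam1 : 1 <= lam) (lamN : lam + 1 <= N%:R) (Nlam : N%:R <= lam + 2).
Let W := lattice_weight phi lam.
Let lam0 : 0 < lam. Proof. exact: lt_le_trans lam1. Qed.

Lemma l1dist_scaled_lattice (w : L) : l1dist (lam^-1 *: map_mx (fun q : int => q%:~R) w) (0 : 'rV[R]_d) =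
  (norm1 w)%:R / lam.
Proof.
rewrite /l1dist /norm1 natr_sum mulr_suml; apply: eq_bigr => i _.
rewrite !mxE subr0 normrM gtr0_norm ?invr_gt0 // mulrC; congr (_ * _).
by rewrite natr_absz intr_norm.
Qed.

Lemma weight_supp w : lam <= (norm1 w)%:R -> W w = 0.
Proof.
move=> lw; apply: (mollifier_supp mol).
by rewrite l1dist_scaled_lattice ler_pdivlMr // mul1r.
Qed.

Lemma weight_itv01 w : 0 <= W w <= 1. Proof. exact: mollifier_itv01 mol _. Qed.

Lemma weight_ge0 w : 0 <= W w. Proof. by have /andP[] := weight_itv01 w. Qed.

Lemma weightN w : W (- w) = W w.
Proof.
rewrite /W /lattice_weight -(mollifier_even mol); congr phi.
by apply/rowP => i; rewrite !mxE mulrNz mulrN opprK.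
Qed.

Lemma weight_box_supp (w y : L) : w \notin box N -> (norm1 y <= 1)%N -> W (w + y) = 0.
Proof.
move=> /notin_box wN y1; apply: weight_supp.
have : (norm1 w <= norm1 (w + y) + 1)%N.
  rewrite -{1}[w](addrK y); apply: leq_trans (norm1D _ _) _; by rewrite norm1N leq_add2l.
move=> wy; have : (N <= norm1 (w + y))%N by move: wN wy; clear; lia.
by rewrite -(ler_nat R) => Nw; have := lamN; lra.
Qed.

Definition weight_mass : R := \sum_(w <- box N) W w.

(** The weight is at least [c] on the box of size [m], the integer part of [a * lam]; this box has
    [(2 * m + 1) ^ d] points, and [2 * m + 1 >= a * lam]. *)
Lemma weight_mass_lower : c * a ^+ d * lam ^+ d <= weight_mass.
Proof.
have [C0 a0 a1 c0] := mollifier_cst mol.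
have al0 : 0 <= a * lam by rewrite mulr_ge0 // ltW.
pose m := Num.truncn (a * lam).
have /andP[m1 m2] := truncn_itv al0; rewrite -/m in m1 m2.
have mN : (m <= N)%N.
  rewrite -(ler_nat R); apply: le_trans m1 _; apply: le_trans lamN.
  by apply: le_trans (_ : lam <= _); [rewrite ger_pMl | rewrite lerDl].
have subN w : w \notin box N -> w \notin box m.
  apply: contra; rewrite !mem_box => /forallP wm; apply/forallP => i.
  exact: leq_trans (wm i) mN.
apply: (@le_trans _ _ (\sum_(w <- box N) (if w \in box m then c else 0))); last first.
  rewrite /weight_mass; apply: ler_sum => w _; case: ifPn => [wm|_]; last exact: weight_ge0.
  apply: (mollifier_lower mol) => i; rewrite !mxE normrM gtr0_norm ?invr_gt0 //.
  rewrite mulrC ler_pdivrMr //; apply: le_trans m1.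
  by rewrite -intr_norm -natr_absz ler_nat; move: wm; rewrite mem_box => /forallP.
rewrite sum_box_fsbig => [|w /subN /negbTE -> //].
rewrite -(@sum_box_fsbig _ _ m) => [|w /negbTE -> //].
rewrite (eq_big_seq (fun=> c)) => [|w -> //].
rewrite big_const_seq count_predT size_box iter_addr addr0 -[leRHS]mulr_natr -mulrA ler_pM2l //.
rewrite natrX -exprMn lerXn2r ?nnegrE //.
apply: le_trans (ltW m2) _; rewrite ler_nat -addnn; clear; lia.
Qed.

Lemma weight_mass_gt0 : 0 < weight_mass.
Proof.
have [C0 a0 a1 c0] := mollifier_cst mol.
by apply: lt_le_trans weight_mass_lower; rewrite !mulr_gt0 // exprn_gt0.
Qed.

Lemma weighted_sum_bound (g : L -> R) (b : R) :
  0 <= b -> (forall w, (norm1 w)%:R < lam -> `|g w| <= b) ->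
  `|\sum_(w <- box N) W w * g w| <= b * weight_mass.
Proof.
move=> b0 gb; apply: le_trans (ler_norm_sum _ _ _) _.
rewrite /weight_mass mulr_sumr; apply: ler_sum => w _.
rewrite normrM ger0_norm ?weight_ge0 // mulrC.
have [wl|lw] := ltP (norm1 w)%:R lam; first by rewrite ler_wpM2r ?weight_ge0 ?gb.
by rewrite weight_supp // !mulr0.
Qed.

(** The weight is even, so the sum equals its reflected copy; averaging the two leaves the midpoint
    identity in every term. *)
Lemma weighted_sum_midpoint (P : L -> R) y :
  (forall z w, P (z + w) + P (z - w) = 2 * P z) ->
  \sum_(w <- box N) W w * P (y + w) = weight_mass * P y.
Proof.
move=> mid.
have W0 w : w \notin box N -> W w = 0.
  by move=> wN; have := weight_box_supp wN (_ : norm1 0 <= 1)%N; rewrite addr0 norm10; apply.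
have E : \sum_(w <- box N) W w * P (y - w) = \sum_(w <- box N) W w * P (y + w).
  rewrite -(@sum_box_reindex _ (fun w => W w * P (y + w)) -%R -%R N opprK opprK).
  - by apply: eq_bigr => w _; rewrite weightN.
  - by move=> w wN; rewrite W0 ?mul0r.
  - by move=> w wN; rewrite weightN W0 ?mul0r.
apply: (mulfI (_ : 2 != 0 :> R)) => //.
rewrite mulr_natl mulr2n -{1}E -big_split /= /weight_mass mulr_suml mulr_sumr.
by apply: eq_bigr => w _; rewrite -mulrDr addrC mid; ring.
Qed.

Definition mollify (u : L -> R) z : R := (\sum_(w <- box N) W w * u (z + w)) / weight_mass.

(** At scale one the kernel vanishes at every nonzero lattice point. *)
Lemma mollify_unit u z : lam = 1 -> mollify u z = u z.
Proof.
move=> l1; rewrite /mollify (eq_bigr (fun w => W w * u z)); last first.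
  move=> w _; have [w0|w0] := posnP (norm1 w); first by rewrite (norm1_eq0 w0) addr0.
  by rewrite weight_supp ?mul0r // l1 ler1n.
by rewrite -mulr_suml -/weight_mass mulrAC divff ?mul1r // gt_eqF // weight_mass_gt0.
Qed.

Lemma mollify_bound u z b :
  0 <= b -> (forall w, (norm1 w)%:R < lam -> `|u (z + w)| <= b) -> `|mollify u z| <= b.
Proof.
move=> b0 ub; rewrite /mollify normrM normfV (gtr0_norm weight_mass_gt0).
by rewrite ler_pdivrMr ?weight_mass_gt0 // weighted_sum_bound.
Qed.

Lemma lap_mollify u z :
  lap (mollify u) z = (\sum_(w <- box N) W w * lap u (z + w)) / weight_mass.
Proof.
rewrite /lap /mollify; under [in RHS]eq_bigr do rewrite mulr_sumr.
rewrite [in RHS]exchange_big /= [RHS]mulr_suml; apply: eq_bigr => i _.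
rewrite mulrA -mulrDl -mulrBl; congr (_ / _).
rewrite mulr_sumr -big_split -sumrB; apply: eq_bigr => w _ /=.
by rewrite (addrAC z) (addrAC z (- _)); ring.
Qed.

(** Summation by parts: shifting by a unit vector leaves no boundary term, thanks to the margin
    between the support and the box. *)
Lemma weighted_sum_lap (g : L -> R) z :
  \sum_(w <- box N) W w * lap g (z + w) = \sum_(w <- box N) lap W w * g (z + w).
Proof.
rewrite /lap; under eq_bigr do rewrite mulr_sumr.
under [in RHS]eq_bigr do rewrite mulr_suml.
rewrite exchange_big [RHS]exchange_big; apply: eq_bigr => i _ /=.
have e1 : (norm1 'e_i <= 1)%N by rewrite norm1_e.
have eN1 : (norm1 (- 'e_i) <= 1)%N by rewrite norm1N norm1_e.
have up : \sum_(w <- box N) W w * g (z + w + 'e_i) = \sum_(w <- box N) W (w - 'e_i) * g (z + w).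
  rewrite -[RHS](@sum_box_reindex _ _ (+%R^~ 'e_i) (+%R^~ (- 'e_i)) N (addrK _) (subrK _)).
  - by apply: eq_bigr => w _; rewrite addrK addrA.
  - by move=> w wN; rewrite weight_box_supp ?mul0r.
  - move=> w wN; rewrite addrK -[w]addr0 weight_box_supp ?mul0r //; by rewrite norm10.
have down : \sum_(w <- box N) W w * g (z + w - 'e_i) = \sum_(w <- box N) W (w + 'e_i) * g (z + w).
  rewrite -[RHS](@sum_box_reindex _ _ (+%R^~ (- 'e_i)) (+%R^~ 'e_i) N (subrK _) (addrK _)).
  - by apply: eq_bigr => w _; rewrite subrK addrA.
  - by move=> w wN; rewrite weight_box_supp ?mul0r.
  - move=> w wN; rewrite subrK -[w]addr0 weight_box_supp ?mul0r //; by rewrite norm10.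
transitivity (\sum_(w <- box N) W w * g (z + w + 'e_i) + \sum_(w <- box N) W w * g (z + w - 'e_i)
   - \sum_(w <- box N) 2 * W w * g (z + w)).
  by rewrite -big_split -sumrB; apply: eq_bigr => w _ /=; ring.
by rewrite up down -big_split -sumrB; apply: eq_bigr => w _ /=; ring.
Qed.

Lemma lap_weight_supp w : lam + 1 <= (norm1 w)%:R -> lap W w = 0.
Proof.
move=> lw; rewrite /lap big1 // => i _.
have near y : (norm1 y <= 1)%N -> W (w + y) = 0.
  move=> y1; apply: weight_supp.
  have : (norm1 w <= norm1 (w + y) + 1)%N.
    rewrite -{1}[w](addrK y); apply: leq_trans (norm1D _ _) _; by rewrite norm1N leq_add2l.
  by rewrite -(ler_nat R) natrD; lra.
have := near 0; rewrite norm10 addr0 => -> //.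
by rewrite !near ?norm1N ?norm1_e // mulr0 subr0 addr0.
Qed.

Lemma lap_weight_bound w : `|lap W w| <= d%:R * C / lam ^+ 2.
Proof.
rewrite /lap; apply: le_trans (ler_norm_sum _ _ _) _.
have -> : d%:R * C / lam ^+ 2 = \sum_(i < d) C * lam^-1 ^+ 2.
  by rewrite sumr_const card_ord -[RHS]mulr_natl exprVn [RHS]mulrA.
apply: ler_sum => i _.
have := mollifier_diff2 mol (lam^-1 *: map_mx (fun q : int => q%:~R) w) i lam^-1.
rewrite /W /lattice_weight.
have -> : lam^-1 *: map_mx (fun q : int => q%:~R) (w + 'e_i) =
   lam^-1 *: map_mx (fun q : int => q%:~R) w + lam^-1 *: delta_mx 0 i :> 'rV[R]_d.
  by rewrite -scalerDr; congr (_ *: _); apply/rowP => k; rewrite !mxE intrD mulrz_nat.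
have -> // : lam^-1 *: map_mx (fun q : int => q%:~R) (w - 'e_i) =
   lam^-1 *: map_mx (fun q : int => q%:~R) w - lam^-1 *: delta_mx 0 i :> 'rV[R]_d.
by rewrite -scalerBr; congr (_ *: _); apply/rowP => k; rewrite !mxE intrB mulrz_nat.
Qed.

(* Moving the Laplacian onto the weight gains the factor [lam^-2]. *)
Lemma weighted_sum_lap_bound (g : L -> R) z b :
  0 <= b -> (forall w, (norm1 w)%:R < lam + 1 -> `|g (z + w)| <= b) ->
  `|\sum_(w <- box N) W w * lap g (z + w)| <= 7 ^+ d * lam ^+ d * (d%:R * C / lam ^+ 2 * b).
Proof.
move=> b0 gb; rewrite weighted_sum_lap.
have [C0 _ _ _] := mollifier_cst mol.
have B0 : 0 <= d%:R * C / lam ^+ 2 by rewrite divr_ge0 ?exprn_ge0 ?(ltW lam0) // mulr_ge0 // ltW.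
apply: le_trans (ler_norm_sum _ _ _) _.
apply: (@le_trans _ _ (\sum_(w <- box N) (d%:R * C / lam ^+ 2 * b))).
  apply: ler_sum => w _; rewrite normrM.
  have [wl|lw] := ltP (norm1 w)%:R (lam + 1); first by rewrite ler_pM ?lap_weight_bound ?gb.
  by rewrite lap_weight_supp // normr0 mul0r (mulr_ge0 B0 b0).
rewrite big_const_seq count_predT size_box iter_addr addr0 -[leLHS]mulr_natl ler_wpM2r ?(mulr_ge0 B0 b0) //.
rewrite natrX -exprMn lerXn2r ?nnegrE ?mulr_ge0 ?(ltW lam0) //.
rewrite -addn1 -muln2 natrD natrM.
by have := Nlam; have := lam1; lra.
Qed.

End Mollification.

Ltac nonneg := repeat first
  [ done | by apply: ltW | apply: mulr_ge0 | apply: addr_ge0 | apply: divr_ge0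
  | apply: exprn_ge0 | apply: powR_ge0 | rewrite invr_ge0 ].

(** * The estimate for real germs at lattice spacing one *)

Section RealGerms.
Set Implicit Arguments.
Unset Strict Implicit.
Unset Printing Implicit Defensive.
Local Open Scope ring_scope.
Context {R : realType} {d : nat}.
Local Notation L := 'rV[int]_d.
Local Notation "''e_' j" := (delta_mx 0 j : L) (at level 8, j at level 2, format "''e_' j").
Implicit Types (w x y z : L).

(** It supplies both small parameters of [germ_estimate]; two eighths make the quarter of [M]
    allowed there. *)
Lemma powR_small (X p : R) : 0 <= X -> 0 < p ->
  exists t : R, [/\ 0 < t, t <= 1 & X * t `^ p <= 8^-1].
Proof.
move=> X0 p0; have Y1 : 1 <= 8 * X + 1 by rewrite lerDr mulr_ge0.
have Y0 : 0 < 8 * X + 1 := lt_le_trans ltr01 Y1.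
exists ((8 * X + 1) `^ (- p^-1)); split; first exact: powR_gt0.
  rewrite -[leRHS](powRr0 (8 * X + 1)); apply: ler_powR => //.
  by rewrite oppr_le0 invr_ge0 ltW.
rewrite -powRrM mulNr mulVf ?gt_eqF // powR_inv1 ?(ltW Y0) //.
by rewrite ler_pdivrMr //; lra.
Qed.

Lemma powR_mul_split_le (s t q alpha eta : R) :
  0 <= s -> s <= q -> 0 <= t -> t <= q -> 0 < alpha -> alpha < eta ->
  s `^ alpha * t `^ (eta - alpha) <= q `^ eta.
Proof.
move=> s0 sq t0 tq a0 ae; have q0 : 0 <= q := le_trans s0 sq.
have [q1|q1] := eqVneq q 0.
  have -> : s = 0 by apply/eqP; rewrite eq_le s0 andbT -q1.
  by rewrite powR0 ?gt_eqF // mul0r powR_ge0.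
have -> : q `^ eta = q `^ alpha * q `^ (eta - alpha).
  by rewrite -powRD ?q1 ?implybT //; congr (_ `^ _); ring.
by apply: ler_pM; rewrite ?powR_ge0 //; apply: ge0_ler_powR; rewrite ?nnegrE //; lra.
Qed.

Lemma powR_le_sqr (q eta : R) : 1 <= q -> eta <= 2 -> q `^ eta <= q ^+ 2.
Proof.
move=> q1 e2; rewrite -(powR_mulrn 2 (le_trans ler01 q1)); exact: ler_powR.
Qed.

Lemma powR_sub2 (q eta : R) : 0 < q -> q `^ (eta - 2) = q `^ eta / q ^+ 2.
Proof.
move=> q0; rewrite powRB; last by rewrite (gt_eqF q0) implybT.
by rewrite (powR_mulrn 2 (ltW q0)).
Qed.

(** What is used of a polynomial of degree at most one: the identity makes the Laplacian vanish and
    is all that exact averaging needs. *)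
Definition midpoint_affine (P : L -> R) := forall z w, P (z + w) + P (z - w) = 2 * P z.

(** The hypotheses at spacing one for a real germ. The pairing in [germ_lap] is an unnormalised sum,
    which accounts for the factor [lam ^+ d]; it is available only with [u x] tested around [x]. *)
Record germ_bounds (phi : 'rV[R]_d -> R) (alpha eta M A S : R) (u : L -> L -> R) : Prop := GermBounds {
  germ_growth : forall x y, `|u x y| <= M * (norm1 (x - y))%:R `^ eta;
  germ_lap : forall x lam N, 1 <= lam -> lam + 1 <= N%:R -> N%:R <= lam + 2 ->
    `|\sum_(w <- box N) lattice_weight phi lam w * lap (u x) (x + w)| <=
      A * lam `^ (eta - 2) * lam ^+ d;
  germ_three_point : forall x y, exists P, midpoint_affine P /\
    forall z, `|u x z - u y z - P z| <=
      S * (norm1 (y - z))%:R `^ alpha *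
          ((norm1 (x - y))%:R + (norm1 (y - z))%:R) `^ (eta - alpha);
  germ_centered : forall x, u x x = 0 /\ forall j, u x (x + 'e_j) = 0 }.

Context (phi : 'rV[R]_d -> R) (C a c : R) (mol : mollifier phi C a c).
Context (alpha eta : R) (alpha0 : 0 < alpha) (alpha1 : alpha < 1) (eta1 : 1 < eta) (eta2 : eta < 2).
Let alpha_eta : alpha < eta. Proof. exact: lt_trans eta1. Qed.
Let eta0 : 0 <= eta. Proof. by apply: ltW; apply: lt_trans eta1. Qed.

Section Mollified.
Context (M A S : R) (M0 : 0 < M) (A0 : 0 <= A) (S0 : 0 <= S).
Context (u : L -> L -> R) (ub : germ_bounds phi alpha eta M A S u).
Context (lam : R) (N : nat) (lam1 : 1 <= lam) (lamN : lam + 1 <= N%:R) (Nlam : N%:R <= lam + 2).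
Let lam0 : 0 < lam. Proof. exact: lt_le_trans lam1. Qed.

Local Notation v x := (mollify phi lam N (u x)).

Lemma three_point_le x y z P q :
  (forall z, `|u x z - u y z - P z| <=
      S * (norm1 (y - z))%:R `^ alpha *
          ((norm1 (x - y))%:R + (norm1 (y - z))%:R) `^ (eta - alpha)) ->
  (norm1 (x - y))%:R + (norm1 (y - z))%:R <= q ->
  `|u x z - u y z - P z| <= S * q `^ eta.
Proof.
move=> /(_ z) uP qle; apply: le_trans uP _; rewrite -mulrA ler_wpM2l //.
apply: powR_mul_split_le => //.
by apply: le_trans qle; rewrite lerDr.
Qed.

(** Testing is allowed only for [u z] around [z], so [u x] is replaced by [u z], a midpoint-affine
    function without Laplacian, and the three-point error. The Laplacian of the error falls on the
    weight, whose shifted support has radius [lam + 1 <= 2 * lam]; dividing by the mass removes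
    [lam ^+ d]. *)
Lemma lap_mollify_germ_bound x z q : (norm1 (x - z))%:R + 2 * lam <= q ->
  `|lap (v x) z| <= (1 + 7 ^+ d * (d%:R * C)) / (c * a ^+ d) *
                    (A * lam `^ (eta - 2) + S / lam ^+ 2 * q `^ eta).
Proof.
move=> qle; have [C0 a0 a1 c0] := mollifier_cst mol.
have [P [Pmid uP]] := germ_three_point ub x z.
have lapP y : lap P y = 0 by rewrite /lap big1 // => j _; rewrite Pmid subrr.
pose E y := u x y - u z y - P y.
have lapu y : lap (u x) y = lap (u z) y + lap E y.
  by rewrite /E !lapB lapP; ring.
have sumE : \sum_(w <- box N) lattice_weight phi lam w * lap (u x) (z + w) =
   \sum_(w <- box N) lattice_weight phi lam w * lap (u z) (z + w) +
   \sum_(w <- box N) lattice_weight phi lam w * lap E (z + w).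
  by rewrite -big_split; apply: eq_bigr => w _; rewrite lapu mulrDr.
have q0 : 0 <= S * q `^ eta by rewrite mulr_ge0 // powR_ge0.
have Eb w : (norm1 w)%:R < lam + 1 -> `|E (z + w)| <= S * q `^ eta.
  move=> wl; apply: (three_point_le uP); apply: le_trans qle.
  by rewrite opprD addNKr norm1N lerD2l; have := lam1; lra.
have b2 := weighted_sum_lap_bound mol lam1 lamN Nlam q0 Eb.
have b1 := germ_lap ub z lam1 lamN Nlam.
have mass := weight_mass_lower mol lam1 lamN.
have mass0 := weight_mass_gt0 mol lam1 lamN.
have ca0 : 0 < c * a ^+ d by rewrite mulr_gt0 // exprn_gt0.
have ld0 : 0 < lam ^+ d by rewrite exprn_gt0.
have X0 : 0 <= A * lam `^ (eta - 2) by rewrite mulr_ge0 // powR_ge0.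
have Y0 : 0 <= S / lam ^+ 2 * q `^ eta by rewrite mulr_ge0 ?powR_ge0 // divr_ge0 // exprn_ge0 // ltW.
have D0 : 0 <= 7 ^+ d * (d%:R * C) by rewrite mulr_ge0 ?exprn_ge0 // mulr_ge0 // ltW.
rewrite lap_mollify normrM normfV (gtr0_norm mass0) ler_pdivrMr // sumE.
apply: le_trans (ler_normD _ _) _; apply: le_trans (lerD b1 b2) _.
apply: (@le_trans _ _ ((1 + 7 ^+ d * (d%:R * C)) *
   (A * lam `^ (eta - 2) + S / lam ^+ 2 * q `^ eta) * lam ^+ d)).
  set X := A * lam `^ _ in X0 *; set D := 7 ^+ d * (d%:R * C) in D0 *.
  have -> : 7 ^+ d * lam ^+ d * (d%:R * C / lam ^+ 2 * (S * q `^ eta)) =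
     D * (S / lam ^+ 2 * q `^ eta) * lam ^+ d by rewrite /D; ring.
  rewrite -mulrDl ler_wpM2r ?(ltW ld0) //.
  set Y := S / _ * _ in Y0 *.
  have := mulr_ge0 D0 X0; lra.
set B := 1 + 7 ^+ d * (d%:R * C) in D0 *; set X := A * _ + _.
have -> : B / (c * a ^+ d) * X * weight_mass phi lam N =
  B * X * (weight_mass phi lam N / (c * a ^+ d)) by ring.
rewrite ler_wpM2l ?ler_pdivlMr //; last by rewrite mulrC.
by rewrite mulr_ge0 // addr_ge0.
Qed.

Lemma mollify_growth x z : `|v x z| <= M * ((norm1 (x - z))%:R + lam) `^ eta.
Proof.
apply: (mollify_bound mol lam1 lamN); first by rewrite mulr_ge0 ?powR_ge0 // ltW.
move=> w wl; apply: le_trans (germ_growth ub x (z + w)) _.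
rewrite ler_wpM2l ?(ltW M0) //; apply: ge0_ler_powR; rewrite ?nnegrE ?addr_ge0 ?(ltW lam0) //.
apply: (@le_trans _ _ ((norm1 (x - z))%:R + (norm1 w)%:R)); last by rewrite lerD2l ltW.
by rewrite -natrD ler_nat opprD addrA -(norm1N w) norm1D.
Qed.

(** At [z = y] the three-point bound vanishes because [alpha > 0], and centering then gives
    [P y = u x y]. As averaging reproduces [P], what remains is the average of [u y] near [y], of
    size [M * lam ^ eta], and of the three-point error. *)
Lemma mollify_close x y q : (norm1 (x - y))%:R + lam <= q ->
  `|v x y - u x y| <= M * lam `^ eta + S * q `^ eta.
Proof.
move=> qle; have [P [Pmid uP]] := germ_three_point ub x y.
have mass0 := weight_mass_gt0 mol lam1 lamN.
have uxy : u x y = P y.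
  have := uP y; rewrite subrr norm10 powR0 ?gt_eqF // mulr0 mul0r normr_le0.
  by have [-> _] := germ_centered ub y; rewrite subr0 subr_eq0 => /eqP.
have -> : v x y - u x y = mollify phi lam N (fun z => u x z - P z) y.
  rewrite /mollify uxy; apply: (mulIf (lt0r_neq0 mass0)).
  rewrite mulrBl !divfK ?lt0r_neq0 // [P y * _]mulrC -(weighted_sum_midpoint mol lam1 lamN _ Pmid).
  by rewrite -sumrB; apply: eq_bigr => w _; rewrite mulrBr.
apply: (mollify_bound mol lam1 lamN).
  by rewrite addr_ge0 // mulr_ge0 ?powR_ge0 // ltW.
move=> w wl; have -> : u x (y + w) - P (y + w) =
  u y (y + w) + (u x (y + w) - u y (y + w) - P (y + w)) by ring.
have yw : norm1 (y - (y + w)) = norm1 w by rewrite opprD addNKr norm1N.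
apply: le_trans (ler_normD _ _) _; apply: lerD.
  apply: le_trans (germ_growth ub _ _) _; rewrite ler_wpM2l ?(ltW M0) // yw.
  by apply: ge0_ler_powR; rewrite ?nnegrE ?(ltW lam0) // ltW.
by apply: (three_point_le uP); apply: le_trans qle; rewrite yw lerD2l ltW.
Qed.

End Mollified.
(* [lam] is the mollification scale: a small multiple [delta] of the distance,
   cut off at one lattice spacing, where mollification does nothing and the
   centering takes over. [K] is the ratio of the large scale to the distance. *)
Lemma germ_absorption_bound (delta : R) (K : nat) (M A S : R) (u : L -> L -> R) x y :
  0 < delta -> delta <= 1 -> (0 < K)%N -> 0 < M -> 0 <= A -> 0 <= S ->
  germ_bounds phi alpha eta M A S u ->
  let D : R := d%:R in let Cg : R := 2 * D + 4 in
  let B : R := (1 + 7 ^+ d * (D * C)) / (c * a ^+ d) / delta ^+ 2 * (Cg * K%:R) ^+ 2 in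
  `|u x y| <= (((72 * D + 2) * (delta `^ eta / delta) +
                 4 * D / delta * Cg ^+ 4 * (K%:R `^ eta / K%:R ^+ 2)) * M +
               (4 * D / delta * (Cg ^+ 2 + Cg * 2 * K%:R) * B + 4) * (A + S)) *
              (norm1 (x - y))%:R `^ eta.
Proof.
move=> delta0 delta1 K0 M0 A0 S0 ub; lazy zeta.
pose D : R := d%:R; pose Cg : R := 2 * D + 4.
pose B : R := (1 + 7 ^+ d * (D * C)) / (c * a ^+ d) / delta ^+ 2 * (Cg * K%:R) ^+ 2.
rewrite -/D -/Cg -/B.
have [C0 a0 a1 c0] := mollifier_cst mol.
rewrite norm1_distC; set r := norm1 (y - x).
have D0 : 0 <= D by [].
have K1 : 1 <= K%:R :> R by rewrite ler1n.
have KR0 : 0 < K%:R :> R by rewrite ltr0n.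
have Cg4 : 4 <= Cg by rewrite /Cg; lra.
have Cg0 : 0 < Cg by lra.
have B0 : 0 <= B.
  by rewrite /B; nonneg.
have [r0|r0] := posnP r.
  have -> : y = x by apply/eqP; rewrite -subr_eq0 (norm1_eq0 r0).
  by have [-> _] := germ_centered ub x; rewrite normr0; nonneg.
have rr1 : 1 <= r%:R :> R by rewrite ler1n.
set rr : R := r%:R in rr1 *; have rr0 : 0 < rr by lra.
set T : R := rr `^ eta; have T0 : 0 < T by exact: powR_gt0.
have powT q : 0 <= q -> (q * rr) `^ eta = q `^ eta * T by move=> q0; rewrite powRM // ltW.
have sq_powT q : 1 <= q -> (q * rr) `^ eta <= q ^+ 2 * T.
  by move=> q1; rewrite powT ?ler_pM2r //; [exact: powR_le_sqr (ltW eta2) | lra].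
have dr0 : 0 < delta * rr by rewrite mulr_gt0.
have drr : delta * rr <= rr by rewrite ger_pMl.
pose lam : R := Num.max 1 (delta * rr).
have lam1 : 1 <= lam by rewrite /lam le_max lexx.
have lamd : delta * rr <= lam by rewrite /lam le_max lexx orbT.
have lamr : lam <= rr by rewrite /lam ge_max rr1.
have lam0 : 0 < lam by lra.
pose N := (Num.truncn lam).+2.
have /andP[tl1 tl2] := truncn_itv (ltW lam0).
have lamN : lam + 1 <= N%:R by move: tl2; rewrite /N -!natr1; lra.
have Nlam : N%:R <= lam + 2 by move: tl1; rewrite /N -!natr1; lra.
pose v := mollify phi lam N (u x).
have vgrow z q : (norm1 (z - x))%:R + lam <= q -> `|v z| <= M * q `^ eta.
  move=> qle; apply: le_trans (mollify_growth M0 ub lam1 lamN x z) _.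
  rewrite ler_wpM2l ?(ltW M0) // norm1_distC; apply: ge0_ler_powR => //.
    by rewrite nnegrE addr_ge0 // ltW.
  by rewrite nnegrE; apply: le_trans qle; rewrite addr_ge0 // ltW.
have CK1 : 1 <= Cg * K%:R by rewrite -[leLHS]mulr1 ler_pM //; lra.
(* [Cg] also serves as a radius: since [lam <= r], adding [2 * lam] to [(2 d + 2) K r] stays within
   [(2 d + 4) K r]. *)
have region z : (norm1 (z - x) <= (2 * d + 2) * (K * r))%N ->
    (norm1 (z - x))%:R + 2 * lam <= Cg * K%:R * rr.
  rewrite -(ler_nat R) !natrM natrD natrM -/rr -/D => zx.
  apply: le_trans (lerD zx (_ : _ <= 2 * (K%:R * rr))) _; last by rewrite /Cg; lra.
  by rewrite ler_pM2l // (le_trans lamr) // ler_peMl // ltW.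
pose H := M * (Cg ^+ 2 * K%:R `^ eta * T).
have Keta0 : 0 < K%:R `^ eta :> R by exact: powR_gt0.
have H0 : 0 < H by rewrite !mulr_gt0 // exprn_gt0.
have vH z : (norm1 (z - x) <= (2 * d + 2) * (K * r))%N -> `|v z| <= H.
  move=> /region zx; apply: le_trans (@vgrow z (Cg * K%:R * rr) _) _; first by lra.
  rewrite /H ler_pM2l // powT ?mulr_ge0 ?(ltW Cg0) // ler_pM2r // powRM ?(ltW Cg0) //.
  by rewrite ler_pM2r //; apply: powR_le_sqr (ltW eta2); lra.
(* [lam >= delta * r] bounds both [lam ^ (eta - 2)] and [lam ^- 2] in terms of [r]; the price
   [delta ^- 2] sits in [B]. *)
pose f := B * (A + S) * T / rr ^+ 2.
have vf z : (norm1 (z - x) <= (2 * d + 2) * (K * r))%N -> `|lap v z| <= f.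
  move=> /region; rewrite norm1_distC => zx.
  apply: le_trans (lap_mollify_germ_bound A0 S0 ub lam1 lamN Nlam zx) _.
  have inv_lam : (lam ^+ 2)^-1 <= ((delta * rr) ^+ 2)^-1.
    by rewrite lef_pV2 ?posrE ?exprn_gt0 // lerXn2r ?nnegrE ?(ltW dr0) ?(ltW lam0).
  have lamT : lam `^ eta <= T by apply: ge0_ler_powR; rewrite ?nnegrE ?(ltW lam0) ?(ltW rr0).
  have powlam : lam `^ (eta - 2) <= T * ((delta * rr) ^+ 2)^-1.
    by rewrite powR_sub2 //; apply: ler_pM => //; nonneg.
  have i0 : 0 <= ((delta * rr) ^+ 2)^-1 by rewrite invr_ge0 exprn_ge0 // ltW.
  have -> : f = (1 + 7 ^+ d * (D * C)) / (c * a ^+ d) *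
      ((Cg * K%:R) ^+ 2 * (A + S) * (T * ((delta * rr) ^+ 2)^-1)).
    rewrite /f /B; set P := (1 + _) / _; field.
    by rewrite !gt_eqF.
  apply: ler_wpM2l.
    by nonneg.
  rewrite mulrDr mulrDl; apply: lerD.
    rewrite -[leLHS]mul1r -mulrA; apply: ler_pM => //; [by nonneg | by rewrite exprn_ege1 | exact: ler_wpM2l].
  have -> : (Cg * K%:R) ^+ 2 * S * (T / (delta * rr) ^+ 2) =
    S * ((delta * rr) ^+ 2)^-1 * ((Cg * K%:R) ^+ 2 * T) by ring.
  apply: ler_pM; [by nonneg | by nonneg | exact: ler_wpM2l | exact: sq_powT].
pose G := Cg ^+ 4 * (K%:R `^ eta / K%:R ^+ 2) * M * T +
          (Cg ^+ 2 + Cg * 2 * K%:R) * B * (A + S) * T.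
pose F b := v (x + b) - v x.
have FD b1 b2 : (norm1 b1 <= r)%N -> (norm1 b2 <= r)%N -> `|F (b1 + b2) - F b1 - F b2| <= G.
  move=> b1r b2r; have := second_increment_bound r0 K0 H0 vH vf b1r b2r.
  have -> : F (b1 + b2) - F b1 - F b2 = v (x + b1 + b2) - v (x + b1) - (v (x + b2) - v x).
    by rewrite /F addrA; ring.
  move=> /le_trans; apply; rewrite -/D -/Cg -/rr le_eqVlt; apply/orP; left; apply/eqP.
  rewrite /G /H /f; field.
  by rewrite !gt_eqF.
(* Each of the two values of [v] in the increment is bounded on scale [3 * lam], and [3 ^ eta <= 9].
   The final [72 * D] is [4 * D] times this 18. *)
pose g := 18 * (delta `^ eta) * M * T.
have de0 : 0 <= delta `^ eta by exact: powR_ge0.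
have MT0 : 0 < M * T by exact: mulr_gt0.
(* If [delta * r <= 1], then [lam = 1], [v = u x], and steps of length one have zero increment by
   centering. Otherwise [s] is the first integer above [lam = delta * r], and the growth bound
   applies. *)
have [s [s0 sr Fs [vx vy]]] : exists s, [/\ (0 < s)%N, (r %/ s)%N%:R <= delta^-1,
    forall j t, (t <= s)%N -> (t <= r)%N -> `|F (t%:Z *: 'e_j)| <= g &
    `|v x| <= delta `^ eta * M * T /\
    `|v y - u x y| <= (delta `^ eta * M + 4 * S) * T].
  have [dr1|dr1] := leP (delta * rr) 1.
    have l1 : lam = 1 by rewrite /lam max_l.
    have vu z : v z = u x z by exact: (mollify_unit mol lam1 lamN).
    exists 1%N; split => //.
    - by rewrite divn1 -/rr -[leRHS]mul1r ler_pdivlMr // mulrC.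
    - move=> j t t1 _; rewrite /F !vu.
      have [-> uxe] := germ_centered ub x.
      have -> : u x (x + t%:Z *: 'e_j) = 0.
        move: t1; case: t => [|[|//]] _; first by rewrite scale0r addr0; case: (germ_centered ub x).
        by rewrite scale1r uxe.
      by rewrite subrr normr0 /g; nonneg.
    - rewrite !vu subrr normr0; have [-> _] := germ_centered ub x.
      by rewrite normr0; split; nonneg.
  have ld : lam = delta * rr by rewrite /lam max_r // ltW.
  have dT : lam `^ eta = delta `^ eta * T by rewrite ld powT // ltW.
  exists (Num.truncn lam).+1; split => //.
  - have s0 : 0 < (Num.truncn lam).+1%:R :> R by rewrite ltr0n.
    apply: (@le_trans _ _ (rr / (Num.truncn lam).+1%:R)).
      by rewrite ler_pdivlMr // -natrM ler_nat leq_trunc_div.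
    rewrite ler_pdivrMr // -ler_pdivrMl ?invr_gt0 // invrK -ld.
    exact: ltW.
  - move=> j t ts _; rewrite /F.
    have tl : t%:R <= 2 * lam.
      apply: (@le_trans _ _ (Num.truncn lam).+1%:R); first by rewrite ler_nat.
      by rewrite -natr1; lra.
    have lam3 : (3 * lam) `^ eta <= 9 * (delta `^ eta * T).
      rewrite powRM ?(ltW lam0) // dT ler_wpM2r //; first by rewrite mulr_ge0 // ltW.
      by have := @powR_le_sqr 3 eta; rewrite (_ : 3 ^+ 2 = 9); [apply; [rewrite ler1n | exact: ltW] | ring].
    apply: le_trans (ler_normB _ _) _.
    have -> : g = M * (9 * (delta `^ eta * T)) + M * (9 * (delta `^ eta * T)).
      by rewrite /g; ring.
    apply: lerD.
      apply: le_trans (@vgrow _ (3 * lam) _) _; last by rewrite ler_pM2l.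
      by rewrite addrAC subrr add0r norm1_scale_e; lra.
    apply: le_trans (@vgrow _ (3 * lam) _) _; last by rewrite ler_pM2l.
    by rewrite subrr norm10; lra.
  - split.
      apply: le_trans (@vgrow _ lam _) _; first by rewrite subrr norm10 add0r.
      by rewrite dT le_eqVlt; apply/orP; left; apply/eqP; ring.
    have q2 : (norm1 (x - y))%:R + lam <= 2 * rr by rewrite norm1_distC -/r -/rr; lra.
    apply: le_trans (mollify_close M0 S0 ub lam1 lamN q2) _.
    rewrite dT [leRHS]mulrDl; apply: lerD; first by rewrite le_eqVlt; apply/orP; left; apply/eqP; ring.
    rewrite -mulrA [leRHS]mulrCA ler_wpM2l //.
    have := sq_powT 2; rewrite (_ : 2 ^+ 2 = 4); last by ring.
    by apply; rewrite ler1n.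
have F0 : F 0 = 0 by rewrite /F addr0 subrr.
have := additive_bootstrap s0 F0 FD Fs (leqnn r).
rewrite -/D => Fb.
have G0 : 0 <= G by apply: le_trans (normr_ge0 _) (FD 0 0 _ _); rewrite norm10.
have g0 : 0 <= g by rewrite /g; nonneg.
have id1 : 1 <= delta^-1 by rewrite invf_ge1.
(* Both [r %/ s] and 1 are at most [1 / delta], so [(r %/ s + 1) (g + G) + 2 G] is at most
   [4 / delta] times [g + G]. *)
have {}Fb : `|F (y - x)| <= 4 * D * delta^-1 * (g + G).
  apply: le_trans Fb _; rewrite [4 * D]mulrC -!mulrA ler_wpM2l //.
  have h1 : (delta^-1 - (r %/ s)%N%:R) * (g + G) >= 0 by apply: mulr_ge0; [rewrite subr_ge0 | exact: addr_ge0].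
  have h2 : (delta^-1 - 1) * (g + G) >= 0 by apply: mulr_ge0; [rewrite subr_ge0 | exact: addr_ge0].
  have h3 : (delta^-1 - 1) * g >= 0 by apply: mulr_ge0 => //; rewrite subr_ge0.
  have h4 : (delta^-1 - 1) * G >= 0 by apply: mulr_ge0 => //; rewrite subr_ge0.
  by move: h1 h2 h3 h4; lra.
have ux : u x y = F (y - x) + v x - (v y - u x y).
  have xy : x + (y - x) = y by rewrite addrC subrK.
  by rewrite /F xy; ring.
rewrite {}ux; apply: le_trans (ler_normB _ _) _.
apply: le_trans (lerD (ler_normD _ _) (lexx _)) _.
apply: le_trans (lerD (lerD Fb vx) vy) _.
have ed : delta `^ eta * (M * T) <= delta `^ eta / delta * (M * T).
  by rewrite ler_pM2r // -[leLHS]mulr1 ler_wpM2l.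
have AT : 0 <= A * T by rewrite mulr_ge0 // ltW.
rewrite -subr_ge0.
set X := (X in 0 <= X).
have -> : X = 2 * (delta `^ eta / delta * (M * T) - delta `^ eta * (M * T)) + 4 * (A * T).
  by rewrite /X /G /g; ring.
by apply: addr_ge0; apply: mulr_ge0 => //; rewrite subr_ge0.
Qed.

(** [delta] is fixed first, using [eta > 1] to make [delta ^ (eta - 1)] small; [K] comes second,
    using [eta < 2] to make [K ^ (eta - 2)] beat a coefficient containing [1 / delta]. Both choices
    depend only on the kernel, the dimension and [eta]. *)
Lemma germ_estimate : exists C0 : R, 0 < C0 /\
  forall (M A S : R) (u : L -> L -> R), 0 < M -> 0 <= A -> 0 <= S ->
  germ_bounds phi alpha eta M A S u ->
  forall x y, `|u x y| <= (M / 4 + C0 * (A + S)) * (norm1 (x - y))%:R `^ eta.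
Proof.
have [C0 a0 a1 c0] := mollifier_cst mol.
pose D : R := d%:R; pose Cg : R := 2 * D + 4.
have D0 : 0 <= D by [].
have Cg0 : 0 < Cg by rewrite /Cg; lra.
have [||delta [delta0 delta1 dP]] := @powR_small (72 * D + 2) (eta - 1);
  [by nonneg | by rewrite subr_gt0 |].
have X0 : 0 <= 4 * D / delta * Cg ^+ 4 by nonneg.
have [|t [t0 t1 tP]] := @powR_small _ (2 - eta) X0; first by rewrite subr_gt0.
pose K := (Num.truncn t^-1).+1.
have KR0 : 0 < K%:R :> R by rewrite ltr0n.
have tK : K%:R^-1 <= t.
  rewrite -[leRHS]invrK lef_pV2 ?posrE ?invr_gt0 //.
  have ti0 : 0 <= t^-1 by nonneg.
  by have /andP[_ /ltW] := truncn_itv ti0.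
pose B : R := (1 + 7 ^+ d * (D * C)) / (c * a ^+ d) / delta ^+ 2 * (Cg * K%:R) ^+ 2.
exists (`|4 * D / delta * (Cg ^+ 2 + Cg * 2 * K%:R) * B + 4| + 1); split.
  by rewrite ltr_pwDr.
move=> M A S u M0 A0 S0 ub x y.
apply: le_trans (germ_absorption_bound (K := K) x y delta0 delta1 _ M0 A0 S0 ub) _ => //.
rewrite -/D -/Cg -/B ler_wpM2r ?powR_ge0 //; apply: lerD; last first.
  by rewrite ler_wpM2r ?addr_ge0 // (le_trans (ler_norm _)) // lerDl.
rewrite [leRHS]mulrC ler_pM2r //.
have -> : delta `^ eta / delta = delta `^ (eta - 1).
  by rewrite powRB ?powRr1 ?(ltW delta0) //; rewrite (gt_eqF delta0) implybT.
have kap : K%:R `^ eta / K%:R ^+ 2 <= t `^ (2 - eta).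
  rewrite -powR_sub2 // (_ : eta - 2 = -1 * (2 - eta)) ?powRrM; last by ring.
  rewrite powR_inv1 ?(ltW KR0) //; apply: ge0_ler_powR; rewrite ?nnegrE //.
  - by rewrite subr_ge0 ltW.
  - by nonneg.
apply: le_trans (lerD dP (le_trans (ler_wpM2l X0 kap) tP)) _; lra.
Qed.

End RealGerms.

(** * From complex germs at spacing [eps] to real germs at spacing one *)

Section Transfer.
Set Implicit Arguments.
Unset Strict Implicit.
Unset Printing Implicit Defensive.
Local Open Scope ring_scope.
Context {R : realType} {d : nat}.
Local Notation L := 'rV[int]_d.
Local Notation "''e_' j" := (delta_mx 0 j : L) (at level 8, j at level 2, format "''e_' j").
(** The Boolean index handles both parts at once, [true] standing for the real part. *)
Definition complex_part (b : bool) (z : R[i]) : R := let: Complex s t := z in if b then s else t.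

Lemma complex_part0 b : complex_part b 0 = 0.
Proof. by case: b. Qed.

Lemma complex_partD b z1 z2 : complex_part b (z1 + z2) = complex_part b z1 + complex_part b z2.
Proof. by case: z1 z2 b => [s1 t1] [s2 t2] []. Qed.

Lemma complex_partN b z : complex_part b (- z) = - complex_part b z.
Proof. by case: z b => [s t] []. Qed.

Lemma complex_partB b z1 z2 : complex_part b (z1 - z2) = complex_part b z1 - complex_part b z2.
Proof. by rewrite complex_partD complex_partN. Qed.

Lemma complex_partZ b (r : R) z : complex_part b (r%:C%C * z) = r * complex_part b z.
Proof. by case: z b => [s t] [] /=; rewrite mul0r ?subr0 ?addr0. Qed.

Lemma complex_partZr b (r : R) z : complex_part b (z * r%:C%C) = complex_part b z * r.
Proof. by rewrite mulrC complex_partZ mulrC. Qed.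

Lemma complex_part_sum b (I : Type) (s : seq I) (f : I -> R[i]) :
  complex_part b (\sum_(i <- s) f i) = \sum_(i <- s) complex_part b (f i).
Proof. exact: (big_morph _ (complex_partD b) (complex_part0 b)). Qed.

Lemma complex_part_le b z : `|complex_part b z| <= cnorm z.
Proof.
case: z b => [s t] [] /=; rewrite -sqrtr_sqr; apply: ler_wsqrtr.
  by rewrite lerDl sqr_ge0.
by rewrite lerDr sqr_ge0.
Qed.

Lemma cnorm_le_parts z : cnorm z <= `|complex_part true z| + `|complex_part false z|.
Proof.
case: z => [s t] /=; rewrite -[leRHS]ger0_norm ?addr_ge0 // -sqrtr_sqr; apply: ler_wsqrtr.
rewrite sqrrD !real_normK ?num_real // -addrA lerD2l lerDr.
by rewrite mulrn_wge0 // mulr_ge0.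
Qed.

Implicit Types (w x y z : L).

Lemma ldistE (eps : R) x y : 0 < eps -> ldist eps x y = eps * (norm1 (x - y))%:R.
Proof.
move=> e0; rewrite /ldist /l1dist /lpos /norm1 natr_sum mulr_sumr.
apply: eq_bigr => i _; rewrite !mxE -mulrBr normrM gtr0_norm //; congr (_ * _).
by rewrite natr_absz -intrB intr_norm.
Qed.

Lemma unit_sphere_seq y :
  [set z | norm1 (y - z) = 1%N]%classic =
  [set` [seq y + 'e_j | j <- index_enum 'I_d] ++ [seq y - 'e_j | j <- index_enum 'I_d]]%classic.
Proof.
apply/seteqP; split => z /=.
  move=> /norm1_predecessor [w [j [/norm1_eq0 -> zj]]].
  rewrite mem_cat; apply/orP; case: zj; rewrite add0r => E.
    by right; apply/mapP; exists j; rewrite ?mem_index_enum // -E subKr.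
  left; apply/mapP; exists j; rewrite ?mem_index_enum //.
  by rewrite -['e_j]opprK -E subKr.
rewrite mem_cat => /orP[] /mapP[j _ ->].
  by rewrite opprD addNKr norm1N norm1_e.
by rewrite subKr norm1_e.
Qed.

Lemma unit_sphere_uniq y :
  uniq ([seq y + 'e_j | j <- index_enum 'I_d] ++ [seq y - 'e_j | j <- index_enum 'I_d]).
Proof.
have einj : injective (fun j : 'I_d => 'e_j).
  by move=> i j /rowP /(_ i); rewrite !mxE !eqxx /=; case: (i =P j).
rewrite cat_uniq; apply/and3P; split.
- by rewrite map_inj_uniq ?index_enum_uniq // => i j /addrI /einj.
- apply/hasPn => z /mapP[j _ ->]; apply/negP => /mapP[k _] /addrI /rowP /(_ j).
  by rewrite !mxE !eqxx /=; case: (j == k).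
- by rewrite map_inj_uniq ?index_enum_uniq // => i j /addrI /oppr_inj /einj.
Qed.

Lemma complex_part_dlapl b (eps : R) (u : L -> R[i]) y : 0 < eps ->
  complex_part b (dlapl eps u y) = eps ^- 2 * lap (fun z => complex_part b (u z)) y.
Proof.
move=> e0; rewrite /dlapl complex_partZ; congr (_ * _).
rewrite (_ : [set z | _]%classic = [set z | norm1 (y - z) = 1%N]%classic); last first.
  apply/seteqP; split => z /=; rewrite ldistE // => E.
    apply/eqP; rewrite -(eqr_nat R) -(inj_eq (mulfI (lt0r_neq0 e0))).
    by rewrite E mulr1.
  by rewrite E mulr1.
rewrite unit_sphere_seq -fsbig_seq ?unit_sphere_uniq //.
rewrite complex_part_sum big_cat !big_map /= -big_split.
by apply: eq_bigr => j _ /=; rewrite !complex_partB; ring.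
Qed.

(** The [eps ^+ d] of the pairing cancels against the normalisation of the kernel at scale
    [eps * lam], leaving [eps ^- 2] from the Laplacian and [lam ^- d]. *)
Lemma complex_part_lpair b (phi : 'rV[R]_d -> R) (C a c : R) (eps lam : R) (N : nat)
    (u : L -> R[i]) x :
  mollifier phi C a c -> 0 < eps -> 1 <= lam -> lam + 1 <= N%:R ->
  complex_part b (lpair eps (dlapl eps u) (rescale phi (lpos eps x) (eps * lam))) =
  eps ^- 2 * lam ^- d *
   \sum_(w <- box N) lattice_weight phi lam w * lap (fun z => complex_part b (u z)) (x + w).
Proof.
move=> mol e0 lam1 lamN; have l0 : 0 < lam by apply: lt_le_trans lam1.
rewrite /lpair complex_partZ (reindex_fsbigT (+%R x)); last first.
  by exists (+%R (- x)) => z; [rewrite addKr | rewrite addNKr].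
have phiw w : rescale phi (lpos eps x) (eps * lam) (lpos eps (x + w)) =
   (eps * lam) ^- d * lattice_weight phi lam w.
  rewrite /rescale /lattice_weight; congr (_ * phi _).
  apply/rowP => i; rewrite !mxE intrD; field.
  by rewrite !gt_eqF.
rewrite -(@sum_box_fsbig _ _ _ N); last first.
  move=> w wN; rewrite phiw (_ : lattice_weight _ _ _ = 0) ?mulr0 //.
  by have := weight_box_supp mol lam1 lamN wN (_ : norm1 0 <= 1)%N; rewrite addr0 norm10; apply.
rewrite complex_part_sum !mulr_sumr; apply: eq_bigr => w _.
rewrite complex_partZr complex_part_dlapl // phiw exprMn.
set l := lap _ _; set lw := lattice_weight _ _ _.
have ed : 0 < eps ^+ d by rewrite exprn_gt0.
have ld : 0 < lam ^+ d by rewrite exprn_gt0.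
move: (eps ^+ d) (lam ^+ d) ed ld => p q p0 q0; field.
by rewrite !gt_eqF.
Qed.

(** Total degree at most one means that the monomial is constant or a single coordinate. *)
Lemma monomial_midpoint (K : comNzRingType) (f g : 'I_d -> K) (e : 'I_d -> nat) :
  (\sum_(i < d) e i <= 1)%N ->
  \prod_(i < d) (f i + g i) ^+ e i + \prod_(i < d) (f i - g i) ^+ e i =
  2 * \prod_(i < d) f i ^+ e i.
Proof.
move=> e1; have [j ej|e0] := pickP (fun j => e j != 0%N); last first.
  by rewrite !big1 ?mulr1 // => i _; move: (e0 i) => /eqP ->.
have [ej1 e0] : e j = 1%N /\ forall i, i != j -> e i = 0%N.
  move: e1; rewrite (bigD1 j) //=; move: ej; case: (e j) => // [] [|n] // _.
  rewrite add1n ltnS leqn0 sum_nat_eq0 => /forallP e0; split=> // i ij.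
  by apply/eqP; have := e0 i; rewrite ij.
have prodE (h : 'I_d -> K) : \prod_(i < d) h i ^+ e i = h j.
  by rewrite (bigD1 j) //= ej1 expr1 big1 ?mulr1 // => i /e0 ->.
by rewrite (prodE (fun i => f i + g i)) (prodE (fun i => f i - g i)) prodE; ring.
Qed.

Lemma lposD_coord (eps : R) z w i :
  lpos eps (z + w) 0 i = lpos eps z 0 i + lpos eps w 0 i.
Proof. by rewrite /lpos !mxE intrD mulrDr. Qed.

Lemma lposB_coord (eps : R) z w i :
  lpos eps (z - w) 0 i = lpos eps z 0 i - lpos eps w 0 i.
Proof. by rewrite /lpos !mxE intrB mulrBr. Qed.

Lemma poly_le1_midpoint b (eps : R) (P : 'rV[R]_d -> R[i]) :
  is_poly_le 1 P -> midpoint_affine (fun z => complex_part b (P (lpos eps z))).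
Proof.
move=> [s [sdeg PE]] z w; rewrite -complex_partD.
have -> : 2 * complex_part b (P (lpos eps z)) = complex_part b (2 * P (lpos eps z)).
  by rewrite mulr_natl mulr2n mulr_natl mulr2n complex_partD.
congr complex_part; rewrite !PE mulr_sumr -big_split /=; apply: eq_big_seq => q qs.
rewrite mulrCA -(monomial_midpoint (fun i => ((lpos eps z) 0 i)%:C%C)
  (fun i => ((lpos eps w) 0 i)%:C%C) (sdeg q qs)) mulrDr.
by congr (_ * _ + _ * _); apply: eq_bigr => i _; congr (_ ^+ _);
  [rewrite lposD_coord rmorphD | rewrite lposB_coord rmorphB].
Qed.

Lemma ceil_order_eq1 (eta : R) : 1 < eta -> eta < 2 -> Num.ceil (- (eta - 2)) = 1.
Proof.
move=> eta1 eta2; apply: ceil_def; rewrite subrr mulr0z mulr1z opprB subr_gt0 eta2 /=.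
by rewrite lerBlDr -lerBlDl (_ : 2 - 1 = 1) ?ltW //; ring.
Qed.

Lemma floor_order_eq1 (eta : R) : 1 < eta -> eta < 2 -> Num.floor eta = 1.
Proof. by move=> eta1 eta2; apply: floor_def; rewrite mulr1z (ltW eta1). Qed.

Context (phi : 'rV[R]_d -> R) (C a c : R) (mol : mollifier phi C a c).
Context (alpha eta : R) (eta1 : 1 < eta) (eta2 : eta < 2).

(** Distances are [eps] times lattice distances, so each constant gains [eps ^ eta]; for the
    Laplacian this is [eps ^ 2], undoing its normalisation, times [eps ^ (eta - 2)] from the test
    scale. *)
Lemma germ_part_bounds b (eps M A S : R) (U : germ R d) : 0 < eps -> centered eps U ->
  (forall x y, cnorm (U x y) <= M * (ldist eps x y) `^ eta) ->
  (Gneg eps (eta - 2) (dlapl_germ eps U) <= A%:E)%E ->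
  (forall x y, exists P, is_poly_le `|Num.floor eta|%N P /\
     forall z, cnorm (U x z - U y z - P (lpos eps z)) <=
       S * (ldist eps y z) `^ alpha * (ldist eps x y + ldist eps y z) `^ (eta - alpha)) ->
  germ_bounds phi alpha eta (M * eps `^ eta) (A * eps `^ eta) (S * eps `^ eta)
    (fun x y => complex_part b (U x y)).
Proof.
move=> e0 Uc UM UA US; have e0' := ltW e0.
split.
- move=> x y; apply: le_trans (complex_part_le b _) _; apply: le_trans (UM x y) _.
  by rewrite ldistE // powRM // mulrA.
- move=> x lam N lam1 lamN _; have l0 : 0 < lam by apply: lt_le_trans lam1.
  have el0 : 0 < eps * lam by apply: mulr_gt0.
  have : (((eps * lam) `^ (- (eta - 2)) *
     cnorm (lpair eps (dlapl eps (U x)) (rescale phi (lpos eps x) (eps * lam))))%:E <= A%:E)%E.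
    apply: le_trans UA; apply: ereal_sup_ubound.
    exists phi, x, (eps * lam); split => //.
      by rewrite ceil_order_eq1 //; exact: mollifier_testfun mol.
    by rewrite ler_peMr.
  rewrite lee_fin powRN mulrC ler_pdivrMr ?powR_gt0 // => bnd.
  have := le_trans (complex_part_le b _) bnd.
  rewrite (complex_part_lpair b (U x) x mol e0 lam1 lamN).
  have k0 : 0 < eps ^- 2 * lam ^- d by rewrite mulr_gt0 // invr_gt0 exprn_gt0.
  rewrite normrM (gtr0_norm k0) mulrC -ler_pdivlMr // => /le_trans; apply.
  rewrite le_eqVlt; apply/orP; left; apply/eqP.
  rewrite powRM ?(ltW l0) // (powR_sub2 eta e0); field.
  by rewrite !gt_eqF // exprn_gt0.
- move=> x y; have [P [Pdeg PU]] := US x y.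
  exists (fun z => complex_part b (P (lpos eps z))); split.
    by apply: poly_le1_midpoint; move: Pdeg; rewrite floor_order_eq1.
  move=> z; rewrite -!complex_partB; apply: le_trans (complex_part_le b _) _.
  apply: le_trans (PU z) _; rewrite !ldistE // -mulrDr !powRM ?addr_ge0 //.
  have -> : eps `^ eta = eps `^ alpha * eps `^ (eta - alpha).
    by rewrite -powRD ?(gt_eqF e0) ?implybT //; congr (_ `^ _); ring.
  rewrite le_eqVlt; apply/orP; left; apply/eqP; ring.
- move=> x; have [Uxx Uxe] := Uc x; split; first by rewrite Uxx complex_part0.
  move=> j; have := congr1 (complex_part b) (Uxe j).
  rewrite complex_partZ Uxx subr0 complex_part0 => /eqP.
  by rewrite mulf_eq0 invr_eq0 (gt_eqF e0) => /eqP.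
Qed.

End Transfer.

(** * Absorption of the norm and conclusion *)

Theorem theorem2p11 (R : realType) (d : nat) (alpha eta : R) :
  (0 < alpha)%R -> (alpha < 1)%R -> (1 < eta)%R -> (eta < 2)%R ->
  exists C : R, (0 < C)%R /\
    forall (eps : R) (U : germ R d), (0 < eps)%R -> centered eps U ->
      Gnorm eps eta U < +oo ->
      Gnorm eps eta U <=
         C%:E * (Gneg eps (eta - 2)%R (dlapl_germ eps U) + Gseminorm eps eta alpha U).
Proof.
move=> alpha0 alpha1 eta1 eta2.
have [phi [B [a [c mol]]]] := @mollifier_exists R d.
have [C0 [C00 main]] := germ_estimate mol alpha0 alpha1 eta1 eta2.
(* Real and imaginary parts together give [M / 2 + 2 * C0 * (A + S)]; absorbing [M / 2] doubles the
   constant to [4 * C0]. *)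
exists (4 * C0)%R; split; first by rewrite mulr_gt0.
move=> eps U e0 Uc; rewrite /Gnorm; set SM := [set _ | _ in _]%classic => Ufin.
have lap_ge0 : 0 <= Gneg eps (eta - 2)%R (dlapl_germ eps U).
  apply: le_trans (ereal_sup_ubound _); last first.
    exists phi, 0%R, eps; split => //.
    by rewrite ceil_order_eq1 //; exact: mollifier_testfun mol.
  by rewrite lee_fin mulr_ge0 ?powR_ge0 // (le_trans (normr_ge0 _) (complex_part_le true _)).
have semi_ge0 : 0 <= Gseminorm eps eta alpha U.
  by apply: le_ereal_inf_tmp => _ [M [M0 _] <-]; rewrite lee_fin ltW.
have M_ge0 : 0 <= ereal_inf SM.
  by apply: le_ereal_inf_tmp => _ [M [M0 _] <-]; rewrite lee_fin ltW.
have C4 : (0 < 4 * C0)%R by rewrite mulr_gt0.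
(* If one of the two seminorms is infinite, so is the right-hand side, because the other is
   nonnegative and the constant positive. *)
case EA : (Gneg eps (eta - 2)%R (dlapl_germ eps U)) lap_ge0 => [A| |] // A0; last first.
  by rewrite addye ?gt0_muley ?lte_fin ?leey // gt_eqF // (lt_le_trans _ semi_ge0) // ltNyr.
rewrite /Gseminorm in semi_ge0 *; set SS := [set _ | _ in _]%classic in semi_ge0 *.
case ES : (ereal_inf SS) semi_ge0 => [S| |] // S0; last first.
  by rewrite addey // gt0_muley ?lte_fin // leey.
(* Finiteness of the norm enters here: absorption needs a real number [m] to subtract. *)
case EM : (ereal_inf SM) M_ge0 Ufin => [m| |] // m0 _.
rewrite lee_fin in A0; rewrite lee_fin in S0; rewrite lee_fin in m0.
rewrite -EFinD -EFinM lee_fin; apply/ler_addgt0Pr => e e_gt0.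
(* The infima are only approached, within [t]. Solving [m <= (m + t) / 2 + 2 C0 (A + S + t)] for [m]
   leaves the excess [t * (1 + 4 * C0) = e]. *)
pose t := (e / (1 + 4 * C0))%R.
have t0 : (0 < t)%R by rewrite divr_gt0 // addr_gt0.
have tE : (t * (1 + 4 * C0))%R = e by rewrite /t divfK // gt_eqF // addr_gt0.
have SMfin : ereal_inf SM \is a fin_num by rewrite EM.
have SSfin : ereal_inf SS \is a fin_num by rewrite ES.
have [_ [M [M0 UM] <-]] := lb_ereal_inf_adherent t0 SMfin.
have [_ [S1 [S10 US] <-]] := lb_ereal_inf_adherent t0 SSfin.
rewrite EM ES -!EFinD !lte_fin => S1t Mt.
pose D := (M / 2 + 2 * (C0 * (A + S1)))%R.
have AS0 : (0 <= C0 * (A + S1))%R by rewrite mulr_ge0 ?addr_ge0 // ltW.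
have D0 : (0 < D)%R by rewrite ltr_pwDl ?divr_gt0 // mulr_ge0.
have ee0 : (0 < eps `^ eta)%R by exact: powR_gt0.
(* [D] is itself an admissible constant for the growth of [U], so the infimum [m] lies below it. *)
have mD : (m <= D)%R.
  rewrite -lee_fin -EM; apply: ereal_inf_lbound; exists D => //; split => // x y.
  have part b : (`|complex_part b (U x y)| <=
      (M / 4 + C0 * (A + S1)) * (ldist eps x y) `^ eta)%R.
    have gb := @germ_part_bounds R d phi B a c mol alpha eta eta1 eta2 b eps M A S1 U e0 Uc UM _ US.
    rewrite ldistE // powRM ?(ltW e0) // mulrA.
    apply: le_trans (main _ _ _ _ _ _ _ (gb _) x y) _.
    - by rewrite mulr_gt0.
    - by rewrite mulr_ge0 // ltW.
    - by rewrite mulr_ge0 // ltW.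
    - by rewrite EA.
    - by rewrite le_eqVlt; apply/orP; left; apply/eqP; ring.
  apply: le_trans (cnorm_le_parts _) _; apply: le_trans (lerD (part true) (part false)) _.
  by rewrite /D le_eqVlt; apply/orP; left; apply/eqP; field.
have C0S : (C0 * S1 <= C0 * (S + t))%R by rewrite ler_pM2l // ltW.
rewrite -tE; move: mD; rewrite /D; lra.
Qed.
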